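(* Let $\mathbb{F}$ be any field and let $L$ be a nilpotent symplectic alternating algebra over $\mathbb{F}$ of dimension $10$ with an isotropic center of dimension $2$ that is of class $7$ and has the further properties that $L^4L^3=L^7$ and $\dim UL^2=2$, where $U=\{x\in L^4:\ xL^3\leq L^5L^2\}$. Then $L$ can be given by a presentation of the form $$\mathcal{P}_{10}^{(2,4)}(r):\quad (x_3y_4,y_5)=r,\ (x_2y_3,y_5)=1,\ (x_1y_2,y_5)=1,\ (x_1y_3,y_4)=1,\ (y_1y_2,y_4)=1,$$ where $r\in\mathbb{F}$, $r\neq 0$. Furthermore two such presentations $\mathcal{P}_{10}^{(2,4)}(r)$ and $\mathcal{P}_{10}^{(2,4)}(s)$ describe the same algebra if and only if $s/r\in(\mathbb{F}^* )^{11}$.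
   Context: A symplectic alternating algebra (SAA) over a field $\mathbb{F}$ is a finite-dimensional vector space $L$ over $\mathbb{F}$ with a non-degenerate alternating bilinear form $(\ ,\ )$ and a bilinear product $\cdot$ satisfying $u\cdot u=0$ for all $u$ and $(u\cdot v,w)=(v\cdot w,u)$ for all $u,v,w\in L$. No associativity or Jacobi identity is assumed. The map $(u,v,w)\mapsto(uv,w)$ is then an alternating trilinear form. A standard basis (in dimension $10$) is a basis $x_1,y_1,\ldots,x_5,y_5$ with $(x_i,x_j)=(y_i,y_j)=0$ and $(x_i,y_j)=\delta_{ij}$ for all $i,j$. Presentations: $L$ is given by a presentation if there is a standard basis for which the listed values of triples $(uv,w)$ hold and $(uv,w)=0$ for all triples of basis elements that are not a reordering of a listed one. Two presentations describe the same algebra if the corresponding $10$-dimensional SAA's are isomorphic (by a linear bijection preserving product and form). $\mathbb{F}^*=\mathbb{F}\setminus\{0\}$, $(\mathbb{F}^* )^{11}=\{a^{11}:a\in\mathbb{F}^*\}$. For subspaces $U,V$, $UV$ is the span of all products $uv$. $L^1=L$, $L^{m+1}=L^mL$. $L$ is nilpotent if $L^{m+1}=\{0\}$ for some $m\ge 0$, and the smallest such $m$ is its (nilpotence) class. The center is $Z(L)=\{x\in L:xL=\{0\}\}$; it is isotropic if $(u,v)=0$ for all $u,v\in Z(L)$. (For $L$ of dimension $10$ and class $7$, $L^5L^2$ is a one-dimensional ideal contained in $L^7=Z(L)$.) *)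

(* Defs.v *)
From HB Require Import structures.
From mathcomp Require Import all_boot all_order all_algebra.

Set Implicit Arguments.
Unset Strict Implicit.
Unset Printing Implicit Defensive.

Import GRing.Theory.
Local Open Scope ring_scope.

Record saa (F : fieldType) := SAA {
  saa_sort :> vectType F;
  form : {biscalar saa_sort};
  mul : {bilinear saa_sort -> saa_sort -> saa_sort};
  form_alt : forall u, form u u = 0;
  form_nondeg : forall u, (forall v, form u v = 0) -> u = 0;
  mul_alt : forall u, mul u u = 0;
  form_mul : forall u v w, form (mul u v) w = form (mul v w) u
}.

Arguments form {F s}.
Arguments mul {F s}.

Section SAATheory.

Variables (F : fieldType) (L : saa F).
Implicit Types (u v x : L) (U V W : {vspace L}).

(* By bilinearity, the products of basis vectors span all products uv;
   see [saa_prodvP]. *)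
Definition saa_prodv U V : {vspace L} :=
  <<[seq mul u v | u <- vbasis U, v <- vbasis V]>>%VS.

Lemma saa_prodvP U V W :
  reflect (forall u v, u \in U -> v \in V -> mul u v \in W)
          (saa_prodv U V <= W)%VS.
Proof.
apply: (iffP span_subvP) => [sUVW u v Uu Vv | sUVW _ /allpairsP[[u v] /= [Uu Vv ->]]].
  rewrite (coord_vbasis Uu) (coord_vbasis Vv) linear_sumlz.
  apply: memv_suml => i _; rewrite linear_sumr; apply: memv_suml => j _.
  rewrite linearZl_LR linearZr_LR /= !memvZ // sUVW //.
  by apply: allpairs_f; apply: memt_nth.
by apply: sUVW; apply: vbasis_mem.
Qed.

(* The subspace { x | xV <= W }, as an intersection of preimages of W;
   see [saa_transpP]. *)
Definition saa_transp V W : {vspace L} :=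
  (\bigcap_(v <- vbasis V) linfun (fun x => mul x v) @^-1: W)%VS.

Lemma saa_transpP V W x :
  reflect (forall v, v \in V -> mul x v \in W) (x \in saa_transp V W).
Proof.
have linE v : linfun (fun z => mul z v) x = mul x v.
  by rewrite (lfunE (applyr mul v)).
rewrite /saa_transp memvE big_seq.
apply: (iffP idP) => [sxW v Vv | xVW].
  rewrite (coord_vbasis Vv) linear_sumr.
  apply: memv_suml => i _; rewrite linearZr_LR; apply: memvZ.
  rewrite -linE memv_preim memvE.
  apply: subv_trans sxW _.
  by rewrite -big_seq (big_rem (vbasis V)`_i) ?memt_nth //= capvSl.
elim/big_ind: _ => [|A B sxA sxB|v /vbasis_mem Vv]; first exact: subvf.
  by rewrite subv_cap sxA.
by rewrite -memvE -memv_preim linE xVW.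
Qed.

Definition saa_center : {vspace L} := saa_transp fullv 0.

Definition isotropic U := forall u v, u \in U -> v \in U -> form u v = 0.

(* The power L^m of the lower central series, for m >= 1. *)
Definition saa_power (m : nat) : {vspace L} :=
  iter m.-1 (fun V => saa_prodv V fullv) fullv.

Definition nilpotent := exists m : nat, saa_power m.+1 = 0%VS.

Definition nilpotent_class (m : nat) :=
  saa_power m.+1 = 0%VS /\ (forall k, (k < m)%N -> saa_power k.+1 <> 0%VS).

End SAATheory.

Arguments saa_center {F} L.
Arguments saa_power {F} L m.
Arguments nilpotent {F} L.
Arguments nilpotent_class {F} L m.

Definition saa_isomorphic (F : fieldType) (L M : saa F) :=
  exists f : {linear L -> M},
    [/\ bijective f,
        forall u v, f (mul u v) = mul (f u) (f v)
      & forall u v, form (f u) (f v) = form u v].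

(* Indices of a standard basis: [inl i] stands for x_(i+1) and [inr i] for
   y_(i+1). *)
Definition bidx := ('I_5 + 'I_5)%type.

Definition standard_basis (F : fieldType) (L : saa F) (e : bidx -> L) :=
  [/\ basis_of fullv (codom e),
      forall i j, form (e (inl i)) (e (inl j)) = 0,
      forall i j, form (e (inr i)) (e (inr j)) = 0
    & forall i j, form (e (inl i)) (e (inr j)) = (i == j)%:R].

(* The entry ((a, b, c), r) lists the value (ab, c) = r. *)
Definition presentation (F : fieldType) := seq (bidx * bidx * bidx * F).

Definition reordering (t t' : bidx * bidx * bidx) :=
  perm_eq [:: t.1.1; t.1.2; t.2] [:: t'.1.1; t'.1.2; t'.2].

Definition given_by (F : fieldType) (L : saa F) (P : presentation F) :=
  exists e : bidx -> L,
    [/\ standard_basis e,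
        forall a b c r, (a, b, c, r) \in P -> form (mul (e a) (e b)) (e c) = r
      & forall a b c, (forall p, p \in P -> ~~ reordering (a, b, c) p.1) ->
          form (mul (e a) (e b)) (e c) = 0].

(* The algebra given by a presentation is unique up to isomorphism, so the
   choice of the representatives L and M is immaterial. *)
Definition same_algebra (F : fieldType) (P Q : presentation F) :=
  exists L M : saa F, [/\ given_by L P, given_by M Q & saa_isomorphic L M].

(* The usual numbering from 1: x_i and y_i for 1 <= i <= 5. *)
Definition bx (i : nat) : bidx := inl (inord i.-1).
Definition by_ (i : nat) : bidx := inr (inord i.-1).

Definition P10_2_4 (F : fieldType) (r : F) : presentation F :=
  [:: (bx 3, by_ 4, by_ 5, r);
      (bx 2, by_ 3, by_ 5, 1);
      (bx 1, by_ 2, by_ 5, 1);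
      (bx 1, by_ 3, by_ 4, 1);
      (by_ 1, by_ 2, by_ 4, 1)].

(* Main.v *)
Require Import Defs.
From HB Require Import structures.
From mathcomp Require Import all_boot all_order all_algebra.
From mathcomp Require Import ring zify.
Import Defs.

(** Write T(u, v, w) = (uv, w), an alternating trilinear form.  Everything
    rests on two elements a and b that generate L modulo L^2, and on the
    products u = ab and w = ub.

    Suppose that (ub)b = au and that (wb, wa) = r^2; such a and b are called
    balanced, and the scalar (wb, wa) their twist.  If also (a, b) = 0, then
    y_4 = a, y_5 = b, y_3 = - u/r, y_2 = w/r, y_1 = - y_2 b and x_1 = y_2 a,
    together with x_2 = a y_1, x_3 = b x_2, x_4 = y_1 y_2 and x_5 = x_2 y_3,
    form a standard basis with the required values of T: a triple that
    involves two of these defining products is evaluated by the form, and the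
    others vanish because the lower central series is orthogonal to itself in
    the appropriate degrees ([given_by_P10_2_4]).

    Balanced generators exist.  Since L^4 L^3 is nonzero, L^7 has dimension at
    least 2, and as (L^i, L^j) = 0 for i + j > 8 the powers L^2, ..., L^5 must
    have dimensions 8, 7, 6, 4, with L^5 the orthogonal complement of L^4
    ([power_dims], [perp_power4]).  One chooses a so that ua lies in L^4; then
    wa and wb span L^4 modulo L^5, and the twist is nonzero.  The condition on
    U L^2 says that au is not a multiple of wa modulo L^5 ([power_top]), which
    makes it possible to achieve (ub)b = au modulo L^5, and then exactly
    ([balance_top], [balance]).  Scaling makes the twist a square, and a
    central correction makes a and b orthogonal ([normal_generators]).

    Any other balanced pair with nonzero twist is triangular in a and b modulo L^2,
    with diagonal coefficients m^2 and m, and its twist is m^11 times that of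
    a and b ([balanced_twist]).  So isomorphic presentations satisfy
    s^2 = m^11 r^2, whence s/r is an eleventh power.  Conversely the basis of
    a concrete model can be rescaled to multiply r by any eleventh power
    ([given_by_rescale]). *)

Import GRing.Theory.
Local Open Scope ring_scope.

Set Implicit Arguments.
Unset Strict Implicit.
Unset Printing Implicit Defensive.

(** * The form, the product and the alternating trilinear form *)

Section Calculus.

Variables (F : fieldType) (L : saa F).
Implicit Types (u v w x y z : L) (c : F) (U V W : {vspace L}).

Lemma saa_mulDl u v w : mul (u + v) w = mul u w + mul v w.
Proof. exact: linearDl. Qed.

Lemma saa_mulDr u v w : mul u (v + w) = mul u v + mul u w.
Proof. exact: linearDr. Qed.

Lemma saa_mulZl c u v : mul (c *: u) v = c *: mul u v.
Proof. exact: linearZl_LR. Qed.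

Lemma saa_mulZr c u v : mul u (c *: v) = c *: mul u v.
Proof. exact: linearZr_LR. Qed.

Lemma saa_mulNl u v : mul (- u) v = - mul u v.
Proof. exact: linearNl. Qed.

Lemma saa_mulNr u v : mul u (- v) = - mul u v.
Proof. exact: linearNr. Qed.

Lemma saa_mul0l u : mul 0 u = 0 :> L.
Proof. exact: linear0l. Qed.

Lemma saa_mul0r u : mul u 0 = 0 :> L.
Proof. exact: linear0r. Qed.

Lemma formDl u v w : form (u + v) w = form u w + form v w.
Proof. exact: linearDl. Qed.

Lemma formDr u v w : form u (v + w) = form u v + form u w.
Proof. exact: linearDr. Qed.

Lemma formZl c u v : form (c *: u) v = c * form u v.
Proof. exact: linearZl_LR. Qed.

Lemma formZr c u v : form u (c *: v) = c * form u v.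
Proof. exact: linearZr_LR. Qed.

Lemma formNl u v : form (- u) v = - form u v.
Proof. exact: linearNl. Qed.

Lemma formNr u v : form u (- v) = - form u v.
Proof. exact: linearNr. Qed.

Lemma form0l u : form 0 u = 0.
Proof. exact: linear0l. Qed.

Lemma form0r u : form u 0 = 0.
Proof. exact: linear0r. Qed.

Definition mulE :=
  (saa_mulDl, saa_mulDr, saa_mulZl, saa_mulZr,
   saa_mulNl, saa_mulNr, saa_mul0l, saa_mul0r).

Definition formE :=
  (formDl, formDr, formZl, formZr, formNl, formNr, form0l, form0r).

Lemma saa_mulC u v : mul u v = - mul v u.
Proof.
apply/eqP; rewrite -addr_eq0; apply/eqP.
by rewrite -(mul_alt (u + v)) !mulE !mul_alt add0r addr0.
Qed.

Lemma formC u v : form u v = - form v u.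
Proof.
apply/eqP; rewrite -addr_eq0; apply/eqP.
by rewrite -(form_alt (u + v)) !formE !form_alt add0r addr0.
Qed.

Definition tri u v w := form (mul u v) w.

Lemma tri_cycle u v w : tri u v w = tri v w u.
Proof. exact: form_mul. Qed.

Lemma tri_swap12 u v w : tri u v w = - tri v u w.
Proof. by rewrite /tri saa_mulC formNl. Qed.

Lemma tri_swap23 u v w : tri u v w = - tri u w v.
Proof. by rewrite tri_cycle tri_swap12 -tri_cycle -tri_cycle. Qed.

Lemma tri_alt12 u w : tri u u w = 0.
Proof. by rewrite /tri mul_alt form0l. Qed.

Lemma tri_alt23 u w : tri w u u = 0.
Proof. by rewrite tri_cycle tri_alt12. Qed.

Lemma tri_alt13 u w : tri u w u = 0.
Proof. by rewrite -tri_cycle tri_alt12. Qed.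

Definition tri_alt := (tri_alt12, tri_alt23, tri_alt13).

Lemma form_mulr u v w : form u (mul v w) = - tri v w u.
Proof. exact: formC. Qed.

(** Vector identities are proved below by pairing both sides with an arbitrary
    z, which turns them into identities that [ring] decides. *)
Lemma form_inj x y : (forall z, form x z = form y z) -> x = y.
Proof.
move=> xy; apply/eqP; rewrite -subr_eq0; apply/eqP/form_nondeg => z.
by rewrite !formE xy subrr.
Qed.

Lemma form_neq0 u : u != 0 -> exists v, form u v != 0.
Proof.
move=> u0; case: (pickP (fun i : 'I_(\dim {:L}) => form u (vbasis {:L})`_i != 0)) => [i ui|noi].
  by exists (vbasis {:L})`_i.
case/eqP: u0; apply: form_nondeg => v.
rewrite (coord_vbasis (memvf v)) linear_sumr big1 // => i _.
by rewrite formZr (eqP (negbFE (noi i))) mulr0.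
Qed.

Lemma prodv_mem U V u v : u \in U -> v \in V -> mul u v \in saa_prodv U V.
Proof. by move: u v; apply/saa_prodvP; apply: subvv. Qed.

Lemma prodv_neq0 U V :
  saa_prodv U V != 0%VS -> exists u v, [/\ u \in U, v \in V & mul u v != 0].
Proof.
move=> n0; have: ~~ (saa_prodv U V <= 0)%VS by rewrite subv0.
rewrite /saa_prodv => /negP nX.
case: (boolP (all (pred1 0) [seq mul u v | u <- vbasis U, v <- vbasis V])).
  by move/allP=> X0; case: nX; apply/span_subvP => x /X0 /eqP ->; exact: mem0v.
case/allPn => _ /allpairsP[[u v] /= [/vbasis_mem uU /vbasis_mem vV ->]] uv.
by exists u, v.
Qed.

Definition perp1 x : {vspace L} := lker (linfun (form x : L -> F^o)).

Lemma mem_perp1 x y : (y \in perp1 x) = (form x y == 0).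
Proof. by rewrite memv_ker lfunE. Qed.

Lemma prodv_not_orth U V x y : y \in saa_prodv U V -> form x y != 0 ->
  exists u v, [/\ u \in U, v \in V & form x (mul u v) != 0].
Proof.
move=> yUV xy.
case: (boolP (all (fun z => form x z == 0) [seq mul u v | u <- vbasis U, v <- vbasis V])).
  move/allP=> X0; case/negP: xy; rewrite -mem_perp1; move: y yUV; apply/subvP.
  by apply/span_subvP => z /X0; rewrite mem_perp1.
case/allPn => _ /allpairsP[[u v] /= [/vbasis_mem uU /vbasis_mem vV ->]] uv.
by exists u, v.
Qed.

Definition orth U V := forall x y, x \in U -> y \in V -> form x y = 0.

(** The trilinear form is cyclic, so a factor can be moved from one side of
    the form to the other; this is what relates the powers L^i and L^j. *)
Lemma orth_prodv W U V :
  orth (saa_prodv W V) U -> orth W (saa_prodv U V).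
Proof.
move=> o x y xW yUV; apply/eqP; apply: contraT => xy.
have [u [v [uU vV]]] := prodv_not_orth yUV xy.
by rewrite form_mulr tri_cycle tri_swap12 /tri o ?prodv_mem // !oppr0 eqxx.
Qed.

(** In coordinates orthogonality says M(U) G M(V)^T = 0, where the Gram matrix
    G is invertible because the form is non-degenerate. *)
Lemma orth_dim U V : orth U V -> (\dim U + \dim V <= \dim {:L})%N.
Proof.
move=> o; set n := \dim {:L}; pose e := vbasis {:L}.
pose G : 'M[F]_n := \matrix_(i, j) form e`_i e`_j.
have fG x y : form x y = ((\row_i coord e i x) *m G *m (\row_j coord e j y)^T) 0 0.
  rewrite {1}(coord_vbasis (memvf x)) {1}(coord_vbasis (memvf y)).
  rewrite linear_sumr !mxE; apply: eq_bigr => j _.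
  rewrite formZr linear_sumlz !mxE mulrC; congr (_ * _).
  by apply: eq_bigr => i _; rewrite formZl !mxE.
have uG : row_free G.
  rewrite -kermx_eq0; apply/eqP/row_matrixP => i.
  rewrite row0; set r := row i _.
  have rG : r *m G = 0 by apply: sub_kermxP; exact: row_sub.
  pose x := \sum_j r 0 j *: e`_j.
  have cx : \row_j coord e j x = r.
    by apply/rowP => j; rewrite mxE coord_sum_free // (basis_free (vbasisP _)).
  have x0 : x = 0 by apply: form_nondeg => y; rewrite fG cx rG mul0mx mxE.
  by rewrite -cx x0; apply/rowP => j; rewrite !mxE linear0.
pose M (A : {vspace L}) : 'M[F]_(\dim A, n) := \matrix_(i, j) coord e j (vbasis A)`_i.
have rM A : \rank (M A) = \dim A.
  apply/eqP; rewrite -/(row_free _) -kermx_eq0; apply/eqP/row_matrixP => i.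
  rewrite row0; set r := row i _.
  have rG : r *m M A = 0 by apply: sub_kermxP; exact: row_sub.
  pose x := \sum_j r 0 j *: (vbasis A)`_j.
  have x0 : x = 0.
    rewrite (coord_vbasis (memvf x)) big1 // => j _.
    suff ->: coord e j x = (r *m M A) 0 j by rewrite rG mxE scale0r.
    rewrite linear_sum mxE; apply: eq_bigr => k _.
    by rewrite linearZ /= !mxE.
  apply/rowP => j; have <- : coord (vbasis A) j x = r 0 j.
    by rewrite coord_sum_free // (basis_free (vbasisP _)).
  by rewrite x0 linear0 mxE.
rewrite -(rM U) -(rM V) -(mxrankMfree (M U) uG) -(mxrank_tr (M V)).
apply: mulmx0_rank_max; apply/matrixP => i j; rewrite [RHS]mxE.
rewrite -[RHS](o (vbasis U)`_i (vbasis V)`_j) ?fG ?vbasis_mem ?mem_nth ?size_tuple //.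
have -> : \row_k coord e k (vbasis U)`_i = row i (M U) by apply/rowP => k; rewrite !mxE.
have -> : \row_k coord e k (vbasis V)`_j = row j (M V) by apply/rowP => k; rewrite !mxE.
by rewrite -row_mul !mxE; apply: eq_bigr => k _; rewrite !mxE.
Qed.

(** One element v outside U spans V over U; the coefficient of v is the
    coordinate that the later arguments read off. *)
Lemma codim1 U V v : (U <= V)%VS -> (\dim V <= (\dim U).+1)%N ->
  v \in V -> v \notin U -> forall x, x \in V -> exists c, x - c *: v \in U.
Proof.
move=> UV dV vV vU x xV.
have /subvP/(_ _ xV) : (V <= U + <[v]>)%VS.
  have sV : (U + <[v]> <= V)%VS by rewrite subv_add UV -memvE.
  rewrite -(geq_leqif (dimv_leqif_sup sV)) (leq_trans dV) // ltnNge.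
  rewrite (geq_leqif (dimv_leqif_sup (addvSl U <[v]>))) subv_add subvv /=.
  by rewrite -memvE.
case/memv_addP => u uU [_ /vlineP[c ->] ->].
by exists c; rewrite addrK.
Qed.

Lemma dimv_proper U V v : (U <= V)%VS -> v \in V -> v \notin U ->
  (\dim U < \dim V)%N.
Proof.
move=> UV vV vU; rewrite ltnNge (geq_leqif (dimv_leqif_sup UV)).
by apply: contra vU => /subvP->.
Qed.

Lemma mem_addv_line U x : x \in (U + <[x]>)%VS.
Proof. by rewrite -{1}[x]add0r memv_add ?mem0v ?memv_line. Qed.

Lemma dim_addv_line U x : x \notin U -> \dim (U + <[x]>) = (\dim U).+1.
Proof.
move=> xU; apply/eqP; rewrite eqn_leq; apply/andP; split.
  rewrite (leq_trans (dimv_add_leqif _ _)) // dim_vline -addn1 leq_add2l.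
  by case: eqP.
exact: dimv_proper (addvSl _ _) (mem_addv_line _ _) xU.
Qed.

End Calculus.

(** * Standard bases and the triples of the presentation *)

Definition code (a : bidx) : nat := match a with inl i => i | inr i => (5 + i)%N end.

Lemma code_inj : injective code.
Proof.
move=> [i|i] [j|j] /= E.
- by congr inl; apply: val_inj.
- by have := ltn_ord i; rewrite E ltnNge leq_addr.
- by have := ltn_ord j; rewrite -E ltnNge leq_addr.
by congr inr; apply: val_inj; apply/eqP; rewrite -(eqn_add2l 5) E.
Qed.

Lemma code_bx k : (0 < k <= 5)%N -> code (bx k) = k.-1.
Proof. by case: k => //= k kP; rewrite inordK. Qed.

Lemma code_by k : (0 < k <= 5)%N -> code (by_ k) = (5 + k.-1)%N.
Proof. by case: k => //= k kP; rewrite inordK. Qed.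

(** The indices [bx] and [by_] go through [inord], which does not reduce.
    Coding basis elements by numbers makes the comparison of a triple with the
    listed ones a computation. *)
Definition supports : seq (seq nat) :=
  [:: [:: 2; 8; 9]; [:: 1; 7; 9]; [:: 0; 6; 9]; [:: 0; 7; 8]; [:: 5; 6; 8]].

Definition unlisted (a b c : bidx) :=
  all (fun t => ~~ perm_eq [:: code a; code b; code c] t) supports.

Lemma unlistedP (F : fieldType) (r : F) a b c :
  reflect (forall p, p \in P10_2_4 r -> ~~ reordering (a, b, c) p.1)
          (unlisted a b c).
Proof.
have reE d e f : reordering (a, b, c) (d, e, f) =
    perm_eq [:: code a; code b; code c] [:: code d; code e; code f].
  apply/idP/idP; first exact: (perm_map code).
  exact: (perm_map_inj code_inj (s := [:: a; b; c]) (t := [:: d; e; f])).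
have -> : unlisted a b c = all (fun p => ~~ reordering (a, b, c) p.1) (P10_2_4 r).
  by rewrite /= !reE !code_bx ?code_by.
exact: allP.
Qed.

(** Dual basis elements have weights adding up to 8, and no listed triple has
    a total above 8.  So a product has at least the sum of the weights of its
    factors, and the elements of weight at least m play the role of L^m. *)
Definition weight (a : bidx) : nat :=
  nth 0%N [:: 4; 5; 6; 7; 7; 4; 3; 2; 1; 1]%N (code a).

Lemma unlisted_swap12 a b c : unlisted a b c = unlisted b a c.
Proof.
apply: eq_all => t; congr (~~ _).
apply: permPl; exact: (permEl (perm_catCA [:: code a] [:: code b] [:: code c])).
Qed.

Lemma unlisted_swap23 a b c : unlisted a b c = unlisted a c b.
Proof.
apply: eq_all => t; congr (~~ _); apply: permPl.
by rewrite perm_cons (perm_catC [:: code b] [:: code c]).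
Qed.

Ltac ord5 i := case: i => [[|[|[|[|[|//]]]]] ?].

Definition dual (a : bidx) : bidx :=
  match a with inl i => inr i | inr i => inl i end.

Lemma dualK : involutive dual. Proof. by case. Qed.

Section Presentation.

Variables (F : fieldType) (L : saa F).
Implicit Types (e : bidx -> L) (r : F).

(** Both the trilinear form, up to sign, and the condition of being unlisted
    are symmetric, so the triples may be sorted by any rank function. *)
Lemma unlisted_wlog (f : bidx -> nat) e :
  (forall a b c, (f a <= f b <= f c)%N -> unlisted a b c ->
     tri (e a) (e b) (e c) = 0) ->
  forall a b c, unlisted a b c -> tri (e a) (e b) (e c) = 0.
Proof.
move=> H.
have H1 a b c : (f a <= f c)%N -> (f b <= f c)%N -> unlisted a b c -> tri (e a) (e b) (e c) = 0.
  move=> ac bc abc; case: (leqP (f a) (f b)) => [ab|/ltnW ba].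
    by apply: H; rewrite ?ab.
  by rewrite tri_swap12 H ?oppr0 ?ba // -unlisted_swap12.
move=> a b c abc; case: (leqP (f a) (f c)) => [ac|/ltnW ca]; last first.
  case: (leqP (f a) (f b)) => [ab|/ltnW ba].
    by rewrite tri_swap23 H1 ?oppr0 ?(leq_trans ca) // -unlisted_swap23.
  by rewrite tri_cycle H1 // unlisted_swap23 -unlisted_swap12.
case: (leqP (f b) (f c)) => [bc|/ltnW cb]; first exact: H1.
by rewrite tri_swap23 H1 ?oppr0 ?(leq_trans ac) // -unlisted_swap23.
Qed.

Definition gram (a b : bidx) : F :=
  match a, b with
  | inl i, inr j => (i == j)%:R
  | inr i, inl j => - (i == j)%:R
  | _, _ => 0
  end.

Lemma gram_dual_sqr a : gram a (dual a) * gram a (dual a) = 1.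
Proof. by case: a => i /=; rewrite eqxx ?mulrNN mulr1. Qed.

Lemma gram_eq0 a b : b != dual a -> gram a b = 0.
Proof.
case: a b => [i|i] [j|j] //= ij; rewrite [i == j](negbTE _) ?oppr0 //.
  by apply: contraNneq ij => ->.
by apply: contraNneq ij => ->.
Qed.

(** Pairing a linear relation with the dual element of a basis element isolates
    its coefficient, so a family with the right Gram matrix is free. *)
Lemma gram_basis e : \dim {:L} = 10%N ->
  (forall a b, form (e a) (e b) = gram a b) -> standard_basis e.
Proof.
move=> dL eg; split; try by move=> i j; rewrite eg.
rewrite basisEfree subvf size_codom dL card_sum !card_ord leqnn andbT andbT.
have edual a b : a != b -> form (e a) (e (dual b)) = 0.
  by rewrite eg eq_sym => ab; rewrite gram_eq0 // (inj_eq (can_inj dualK)).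
have edd a : form (e a) (e (dual a)) != 0.
  by rewrite eg; case: a => i /=; rewrite eqxx ?oppr_eq0 oner_eq0.
rewrite -[codom e]/(tval (codom_tuple e)); apply/freeP => k k0 i.
have := congr1 (fun x => form x (e (dual (enum_val i)))) k0.
rewrite form0l linear_sumlz (bigD1 i) //= big1 => [|j ji].
  rewrite addr0 formZl codomE (nth_map (enum_val i)) -?cardE // -enum_val_nth.
  by move/eqP; rewrite mulf_eq0 (negbTE (edd _)) orbF => /eqP.
rewrite formZl codomE (nth_map (enum_val i)) -?cardE // -enum_val_nth.
by rewrite edual ?mulr0 // (inj_eq enum_val_inj).
Qed.

Lemma std_gram e : standard_basis e -> forall a b, form (e a) (e b) = gram a b.
Proof.
by case=> _ exx eyy exy [i|i] [j|j] //=; rewrite formC exy eq_sym.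
Qed.

End Presentation.

(** * Pairs of generators that produce the presentation *)

Section Filtration.

Variables (F : fieldType) (L : saa F).
Implicit Types (x y z a b : L).

(** The part of the lower central series used below.  It is satisfied by the
    powers L^2, ..., L^5 of an algebra of class 7 as in the theorem, and by the
    weight filtration of an algebra that is given by the presentation. *)
Record filtration (V2 V3 V4 V5 : {vspace L}) : Prop := Filtration {
  sub32 : (V3 <= V2)%VS;
  sub43 : (V4 <= V3)%VS;
  sub54 : (V5 <= V4)%VS;
  mul1 : forall x y, mul x y \in V2;
  mul2 : forall x y, x \in V2 -> mul x y \in V3;
  mul3 : forall x y, x \in V3 -> mul x y \in V4;
  mul4 : forall x y, x \in V4 -> mul x y \in V5;
  mul32 : forall x y, x \in V3 -> y \in V2 -> mul x y \in V5;
  orth45 : orth V4 V5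
}.

(** With u = ab this reads (ub)b = au.  In the presentation, where y_4 = a and
    y_5 = b, the two sides are multiples of y_2 y_5 and y_3 y_4, which are both
    equal to - y_1. *)
Definition balanced a b := mul (mul (mul a b) b) b = mul a (mul a b).

(** This scalar is r^2 for the generators y_4, y_5 of the presentation, and it
    is multiplied by an eleventh power when the balanced generators change. *)
Definition twist a b :=
  form (mul (mul (mul a b) b) b) (mul (mul (mul a b) b) a).

Variables (V2 V3 V4 V5 : {vspace L}).
Hypothesis fV : filtration V2 V3 V4 V5.

Lemma tri_44 x y z : x \in V4 -> y \in V4 -> tri x y z = 0.
Proof.
by move=> xV yV; rewrite -tri_cycle tri_swap12 /tri formC (orth45 fV) ?opprK ?oppr0 // (mul4 fV).
Qed.

Lemma tri_432 x y z : x \in V4 -> y \in V3 -> z \in V2 -> tri x y z = 0.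
Proof.
by move=> xV yV zV; rewrite tri_cycle /tri formC (orth45 fV) ?oppr0 // (mul32 fV).
Qed.

(** From balanced generators a = y_4 and b = y_5 the rest of the basis is
    obtained by products.  The relations listed in the presentation say exactly
    what y_4 y_5, y_3 y_5, y_2 y_5, y_3 y_4 and y_2 y_4 are, so a value of the
    trilinear form on a triple containing one of these pairs is a value of the
    form.  The Gram matrix follows in turn from the identities
    (uv, u) = (uv, v) = 0, the filtration, (a, b) = 0 and the twist. *)
Section StandardBasis.

Variables (r : F) (a b : L).
Hypotheses (dL : \dim {:L} = 10%N) (r0 : r != 0) (ab0 : form a b = 0).
Hypotheses (bal : balanced a b) (tw : twist a b = r ^+ 2).

Let u := mul a b.
Let w := mul u b.
Let y3 := - r^-1 *: u.
Let y2 := r^-1 *: w.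
Let y1 := - mul y2 b.
Let x1 := mul y2 a.
Let x2 := mul a y1.
Let x3 := mul b x2.
Let x4 := mul y1 y2.
Let x5 := mul x2 y3.

Let y3V : y3 \in V2. Proof. by rewrite memvZ // (mul1 fV). Qed.
Let y2V : y2 \in V3. Proof. by rewrite memvZ // (mul2 fV) // (mul1 fV). Qed.
Let y1V : y1 \in V4. Proof. by rewrite memvN (mul3 fV). Qed.
Let x1V : x1 \in V4. Proof. by rewrite (mul3 fV). Qed.
Let V4r x y : y \in V4 -> mul x y \in V5.
Proof. by move=> yV; rewrite saa_mulC memvN (mul4 fV). Qed.
Let s54 x : x \in V5 -> x \in V4. Proof. exact: (subvP (sub54 fV)). Qed.
Let x2V : x2 \in V5. Proof. exact: V4r. Qed.
Let x3V : x3 \in V5. Proof. exact/V4r/s54. Qed.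
Let x4V : x4 \in V5. Proof. by rewrite (mul4 fV). Qed.
Let x5V : x5 \in V5. Proof. by rewrite (mul4 fV) // s54. Qed.

Let p45 : mul a b = - r *: y3.
Proof. by rewrite scalerA mulrNN divff ?scale1r. Qed.
Let p35 : mul y3 b = - y2.
Proof. by rewrite /y3 saa_mulZl scaleNr. Qed.
Let p25 : mul y2 b = - y1.
Proof. by rewrite opprK. Qed.
Let p24 : mul y2 a = x1.
Proof. by []. Qed.
Let p34 : mul y3 a = - y1.
Proof.
rewrite /y3 saa_mulZl saa_mulC scaleNr scalerN opprK /u -bal opprK.
by rewrite /y2 saa_mulZl.
Qed.

Let T45 z : tri a b z = - r * form y3 z. Proof. by rewrite /tri p45 formZl. Qed.
Let T35 z : tri y3 b z = - form y2 z. Proof. by rewrite /tri p35 formNl. Qed.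
Let T25 z : tri y2 b z = - form y1 z. Proof. by rewrite /tri p25 formNl. Qed.
Let T34 z : tri y3 a z = - form y1 z. Proof. by rewrite /tri p34 formNl. Qed.
Let T24 z : tri y2 a z = form x1 z. Proof. by rewrite /tri p24. Qed.

Let o45 x y : x \in V4 -> y \in V5 -> form x y = 0. Proof. exact: (orth45 fV). Qed.
Let o55 x y : x \in V5 -> y \in V5 -> form x y = 0. Proof. by move/s54; apply: o45. Qed.

Let C x y : form x y = 0 -> form y x = 0.
Proof. by move=> xy; rewrite formC xy oppr0. Qed.

Let f34 : form y3 a = 0.
Proof. by apply: (mulfI (_ : - r != 0)); rewrite ?oppr_eq0 // -T45 tri_alt mulr0. Qed.
Let f35 : form y3 b = 0.
Proof. by apply: (mulfI (_ : - r != 0)); rewrite ?oppr_eq0 // -T45 tri_alt mulr0. Qed.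
Let f23 : form y2 y3 = 0.
Proof. by apply: oppr_inj; rewrite -T35 tri_alt oppr0. Qed.
Let f25 : form y2 b = 0.
Proof. by apply: oppr_inj; rewrite -T35 tri_alt oppr0. Qed.
Let f12 : form y1 y2 = 0.
Proof. by apply: oppr_inj; rewrite -T25 tri_alt oppr0. Qed.
Let f15 : form y1 b = 0.
Proof. by apply: oppr_inj; rewrite -T25 tri_alt oppr0. Qed.
Let f13 : form y1 y3 = 0.
Proof. by apply: oppr_inj; rewrite -T34 tri_alt oppr0. Qed.
Let f14 : form y1 a = 0.
Proof. by apply: oppr_inj; rewrite -T34 tri_alt oppr0. Qed.
Let f24 : form y2 a = 0.
Proof. by apply: oppr_inj; rewrite -T35 tri_swap23 T34 f15 !oppr0. Qed.

Let g11 : form x1 y1 = 1.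
Proof.
rewrite /x1 /y1 /y2 !saa_mulZl !formE formC -[form (mul w b) _]/(twist a b) tw.
by field.
Qed.
Let g12 : form x1 y2 = 0. Proof. by rewrite -T24 tri_alt. Qed.
Let g14 : form x1 a = 0. Proof. by rewrite -T24 tri_alt. Qed.
Let g13 : form x1 y3 = 0.
Proof. by rewrite -T24 -tri_cycle tri_swap23 T34 f12 !oppr0. Qed.
Let g15 : form x1 b = 0.
Proof. by rewrite -T24 tri_cycle T45 formC f23 oppr0 mulr0. Qed.

Let T41 z : tri a y1 z = form x2 z. Proof. by []. Qed.
Let g22 : form x2 y2 = 1. Proof. by rewrite -T41 -tri_cycle T24. Qed.
Let g24 : form x2 a = 0. Proof. by rewrite -T41 tri_alt. Qed.
Let g23 : form x2 y3 = 0. Proof. by rewrite -T41 -tri_cycle T34 form_alt oppr0. Qed.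
Let g25 : form x2 b = 0.
Proof. by rewrite -T41 tri_swap23 T45 formC f13 !oppr0 mulr0 oppr0. Qed.
Let h2 y : y \in V4 -> form x2 y = 0.
Proof. by move=> yV; rewrite formC o45 ?oppr0. Qed.

Let T52 z : tri b x2 z = form x3 z. Proof. by []. Qed.
Let g35 : form x3 b = 0. Proof. by rewrite -T52 tri_alt. Qed.
Let g34 : form x3 a = 0. Proof. by rewrite -T52 -tri_cycle T45 formC g23 oppr0 mulr0. Qed.

Let g33 : form x3 y3 = 1.
Proof. by rewrite -T52 -tri_cycle T35 -formC g22. Qed.
Let g32 : form x3 y2 = 0.
Proof. by rewrite -T52 -tri_cycle T25 o45 ?oppr0. Qed.

Let T12 z : tri y1 y2 z = form x4 z. Proof. by []. Qed.
Let g42 : form x4 y2 = 0. Proof. by rewrite -T12 tri_alt. Qed.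
Let g43 : form x4 y3 = 0. Proof. by rewrite -T12 tri_432. Qed.
Let g44 : form x4 a = 1. Proof. by rewrite -T12 tri_cycle T24. Qed.
Let g45 : form x4 b = 0. Proof. by rewrite -T12 tri_cycle T25 form_alt oppr0. Qed.

Let T23 z : tri x2 y3 z = form x5 z. Proof. by []. Qed.
Let g53 : form x5 y3 = 0. Proof. by rewrite -T23 tri_alt. Qed.
Let g52 : form x5 y2 = 0.
Proof. by rewrite -T23 tri_swap23 tri_432 ?oppr0 // s54. Qed.
Let g54 : form x5 a = 0. Proof. by rewrite -T23 tri_cycle T34 o45 ?oppr0. Qed.
Let g55 : form x5 b = 1. Proof. by rewrite -T23 tri_cycle T35 -formC g22. Qed.

Let e (i : bidx) : L :=
  match i with
  | inl i => [:: x1; x2; x3; x4; x5]`_i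
  | inr i => [:: y1; y2; y3; a; b]`_i
  end.

Let e_gram i j : form (e i) (e j) = gram F i j.
Proof.
have xx k l : form (e (inl k)) (e (inl l)) = 0.
  by ord5 k; ord5 l; rewrite /e /=;
    first [exact: form_alt | exact: o55 | exact: o45 | exact/C/o45].
have yy k l : form (e (inr k)) (e (inr l)) = 0.
  by ord5 k; ord5 l; rewrite /e /=; first [exact: form_alt | done | exact: C].
have xy k l : form (e (inl k)) (e (inr l)) = (k == l)%:R.
  by ord5 k; ord5 l; rewrite /e /=; first [done | exact: h2 | exact: o45 | exact/C/o45].
by case: i j => [i|i] [j|j]; rewrite ?xx ?yy ?xy // formC xy /= eq_sym.
Qed.

(** Sorted by weight, a triple has its last two elements in V4, where the
    trilinear form vanishes by [tri_44], or it begins with two of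
    y_2, ..., y_5.  The only such pair whose product is not known is
    y_2, y_3, and it is dealt with by [tri_432]. *)
Theorem given_by_P10_2_4 : given_by L (P10_2_4 r).
Proof.
exists e; split; first exact: gram_basis dL e_gram.
  have eq_code i i' : code i = code i' -> e i = e i' by move/code_inj->.
  have [q1 q2 q3] : [/\ e (bx 1) = x1, e (bx 2) = x2 & e (bx 3) = x3].
    by rewrite /e /= !inordK.
  have [q4 q5 q6] : [/\ e (by_ 1) = y1, e (by_ 2) = y2 & e (by_ 3) = y3].
    by rewrite /e /= !inordK.
  have [q7 q8] : e (by_ 4) = a /\ e (by_ 5) = b.
    by rewrite /e /= !inordK.
  move=> i j k s; rewrite !inE => /or4P[|||/orP[]] /eqP[-> -> -> ->];
    rewrite -/(tri _ _ _) ?(q1, q2, q3, q4, q5, q6, q7, q8).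
  - by rewrite tri_cycle T45 formC g33 mulrN1 opprK.
  - by rewrite tri_cycle T35 -formC g22.
  - by rewrite tri_cycle T25 -formC g11.
  - by rewrite tri_cycle T34 -formC g11.
  - by rewrite tri_cycle T24.
move=> i j k /unlistedP; move: i j k.
apply: (unlisted_wlog (f := weight)) => i j k /andP[ij jk].
have V4f l : (3 < weight l)%N -> e l \in V4.
  case: l => l; ord5 l => //= _; exact: s54.
case: (ltnP 3 (weight j)) => [j4|j3]; first by rewrite tri_cycle tri_44 ?V4f ?(leq_trans j4).
have Z45 z : form y3 z = 0 -> tri a b z = 0 by move=> yz; rewrite T45 yz mulr0.
have Z35 z : form y2 z = 0 -> tri b y3 z = 0 by rewrite tri_swap12 T35 opprK.
have Z25 z : form y1 z = 0 -> tri b y2 z = 0 by rewrite tri_swap12 T25 opprK.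
have Z34 z : form y1 z = 0 -> tri a y3 z = 0 by rewrite tri_swap12 T34 opprK.
have Z24 z : form x1 z = 0 -> tri a y2 z = 0.
  by move=> xz; rewrite tri_swap12 T24 xz oppr0.
have ba z : tri a b z = 0 -> tri b a z = 0 by move=> abz; rewrite tri_swap12 abz oppr0.
have Z23 z : z \in V4 -> tri y3 y2 z = 0 by move=> zV; rewrite -tri_cycle tri_swap23 tri_432 ?oppr0.
have i3 := leq_trans ij j3; move: i3 ij j3 jk.
case: i => i; ord5 i => //=; case: j => j; ord5 j => //= _ _ _;
  case: k => k; ord5 k => //= _; move=> abc;
  rewrite /e /= ?tri_alt //; try apply: ba;
  first [apply: Z45 | apply: Z35 | apply: Z25 | apply: Z34 | apply: Z24 | apply: Z23];
  first [done | exact: form_alt | exact: o45 | exact: s54 | exact: C].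
Qed.

End StandardBasis.
End Filtration.

(** * Changing the generators *)

Section Generators.

Variables (F : fieldType) (L : saa F).
Variables (V2 V3 V4 V5 : {vspace L}).
Hypothesis fV : filtration V2 V3 V4 V5.
Implicit Types (x y z a b v : L).

(** The successive quotients of L > V2 > V3 > V4 are spanned by {a, b}, by u
    and by ub, where u = ab.  If ub is not in V4, the x in L with ux in V4 form
    a single line modulo V2, and by [gen4] it is the line of a. *)
Record generators a b : Prop := Generators {
  gen1 : forall x, exists c d, x - (c *: a + d *: b) \in V2;
  gen2 : forall x, x \in V2 -> exists c, x - c *: mul a b \in V3;
  gen3 : forall x, x \in V3 -> exists c, x - c *: mul (mul a b) b \in V4;
  gen4 : mul (mul a b) a \in V4
}.

(** Modulo V3 the space V2 is the line of ab.  As (ab)(ab) = 0, only products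
    of V3 with V2 contribute. *)
Lemma mul22 a b x y : generators a b ->
  x \in V2 -> y \in V2 -> mul x y \in V5.
Proof.
move=> g xV yV; have [c xc] := gen2 g xV; have [d yd] := gen2 g yV.
set u := mul a b in xc yd.
have uV : u \in V2 by exact: (mul1 fV).
have -> : mul x y = mul (x - c *: u) y - mul (y - d *: u) (c *: u).
  apply: form_inj => z; rewrite !mulE !formE mul_alt form0l [mul u y]saa_mulC.
  rewrite formNl; ring.
by rewrite memvB // (mul32 fV) // memvZ.
Qed.

Section GeneratorChange.

Variables a b : L.
Hypothesis g : generators a b.
Let u := mul a b.
Let w := mul u b.

Let uV : u \in V2. Proof. exact: (mul1 fV). Qed.
Let r1 x y : x \in V2 -> mul y x \in V3.
Proof. by move=> xV; rewrite saa_mulC memvN (mul2 fV). Qed.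
Let s54 x : x \in V5 -> x \in V4. Proof. exact: (subvP (sub54 fV)). Qed.

Variables (l l' n m : F) (v v' : L).
Hypotheses (vV : v \in V2) (vV' : v' \in V2).
Let a' := l *: a + l' *: b + v.
Let b' := n *: a + m *: b + v'.
Let d := l * m - l' * n.
Let u' := mul a' b'.

(** The product of two generators changes by the determinant of the
    substitution. *)
Lemma mod3_mul : u' - d *: u \in V3.
Proof.
have -> : u' - d *: u = mul v b' + mul (l *: a + l' *: b) v'.
  apply: form_inj => z; rewrite /u' /a' /b' !mulE !formE !mul_alt.
  by rewrite [mul b a]saa_mulC /u /d !formE; ring.
by apply: memvD; [exact: (mul2 fV) | exact: r1].
Qed.

Lemma mod4_mul (x y : F) v0 : v0 \in V2 ->
  mul u' (x *: a + y *: b + v0) - (d * y) *: w \in V4.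
Proof.
move=> v0V; have -> : mul u' (x *: a + y *: b + v0) - (d * y) *: w =
   mul (u' - d *: u) (x *: a + y *: b + v0) + (d * x) *: mul u a + d *: mul u v0.
  by apply: form_inj => z; rewrite !mulE !formE -/w; ring.
apply: memvD; first apply: memvD.
- by apply: (mul3 fV); exact: mod3_mul.
- by apply: memvZ; exact: gen4 g.
by apply: memvZ; apply: s54; exact: (mul22 g).
Qed.

End GeneratorChange.

(** A change of generators that keeps [gen4] is triangular modulo V2, and all
    the iterated products in the twist are then scaled. *)
Section TriangularChange.

Variables a b : L.
Hypothesis g : generators a b.
Let u := mul a b.
Let w := mul u b.

Variables (l n m : F) (v v' : L).
Hypotheses (vV : v \in V2) (vV' : v' \in V2).
Let a' := l *: a + v.
Let b' := n *: a + m *: b + v'.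
Let u' := mul a' b'.
Let w' := mul u' b'.

Let a'E : a' = l *: a + 0 *: b + v. Proof. by rewrite scale0r addr0. Qed.
Let r23 x y : x \in V2 -> y \in V3 -> mul x y \in V5.
Proof. by move=> xV yV; rewrite saa_mulC memvN (mul32 fV). Qed.
Let wV : w \in V3. Proof. by rewrite (mul2 fV) // (mul1 fV). Qed.

Lemma triangular_u : u' - (l * m) *: u \in V3.
Proof. by have := mod3_mul a b l 0 n m vV vV'; rewrite mul0r subr0 -a'E. Qed.

Lemma triangular_w : w' - (l * m ^+ 2) *: w \in V4.
Proof.
have := mod4_mul g l 0 n m vV vV' n m vV'.
by rewrite mul0r subr0 -a'E -mulrA -expr2.
Qed.

Lemma triangular_wx (x y : F) v0 : v0 \in V2 ->
  mul w' (x *: a + y *: b + v0) -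
    (l * m ^+ 2) *: (x *: mul w a + y *: mul w b) \in V5.
Proof.
move=> v0V.
have -> : mul w' (x *: a + y *: b + v0) -
    (l * m ^+ 2) *: (x *: mul w a + y *: mul w b) =
  mul (w' - (l * m ^+ 2) *: w) (x *: a + y *: b + v0) + (l * m ^+ 2) *: mul w v0.
  by apply: form_inj => z; rewrite !mulE !formE; ring.
apply: memvD; first by apply: (mul4 fV); exact: triangular_w.
by apply: memvZ; exact: (mul32 fV).
Qed.

(** (ub)b and (ub)a are scaled by l m^3 and l^2 m^2 modulo V5; the multiple of
    (ub)a that is added to (ub)b is orthogonal to (ub)a. *)
Lemma triangular_twist : twist a' b' = l ^+ 3 * m ^+ 5 * twist a b.
Proof.
have := triangular_wx n m vV'; rewrite -/b' => p.
have := triangular_wx l 0 vV; rewrite -a'E => q.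
have wxV x : mul w x \in V4 by rewrite (mul3 fV).
have w'xV x : mul w' x \in V4 by rewrite (mul3 fV) // (mul2 fV) // (mul1 fV).
rewrite /twist -/u' -/w' -/u -/w.
have E1 := orth45 fV (w'xV b') q; have E2 := orth45 fV (wxV a) p.
have -> : form (mul w' b') (mul w' a') = l * m ^+ 2 * l * form (mul w' b') (mul w a).
  by apply/eqP; rewrite -subr_eq0 -E1 !formE; apply/eqP; ring.
have -> : form (mul w' b') (mul w a) = l * m ^+ 2 * m * form (mul w b) (mul w a).
  rewrite formC [form (mul w b) _]formC; apply/eqP; rewrite -subr_eq0 -oppr0 -E2.
  by rewrite !formE form_alt; apply/eqP; ring.
by ring.
Qed.

(** Pairing both sides of the relation (ub)b = au with (ub)a: the left one is
    scaled by l m^3 and the right one by l^2 m, so that l = m^2. *)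
Lemma triangular_balanced : balanced a b -> balanced a' b' ->
  (l * m) * (m ^+ 2 - l) * twist a b = 0.
Proof.
move=> bal bal'.
have [c cV] := gen3 g triangular_u.
have wxV x : mul w x \in V4 by rewrite (mul3 fV).
have : mul a' u' - ((l ^+ 2 * m) *: mul a u + (l * c) *: mul a w) \in V5.
  set t := _ - c *: _ in cV.
  have -> : mul a' u' - ((l ^+ 2 * m) *: mul a u + (l * c) *: mul a w) =
     mul a' t + mul v (l *: (m *: u) + c *: w).
    by apply: form_inj => z; rewrite /t /a' !mulE !formE /w /u; ring.
  apply: memvD; first by rewrite saa_mulC memvN (mul4 fV).
  rewrite !mulE; apply: memvD; apply: memvZ; last exact: r23.
  by apply: memvZ; apply: (mul22 g) => //; exact: (mul1 fV).
move/(orth45 fV (wxV a)) => E1.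
have E2 := orth45 fV (wxV a) (triangular_wx n m vV'); rewrite -/b' in E2.
have {}E2 : form (mul w a) (mul w' b') = l * m ^+ 3 * form (mul w a) (mul w b).
  by apply/eqP; rewrite -subr_eq0 -E2 !formE form_alt; apply/eqP; ring.
have {}E1 : form (mul w a) (mul a' u') = l ^+ 2 * m * form (mul w a) (mul w b).
  apply/eqP; rewrite -subr_eq0 -E1 !formE [mul a w]saa_mulC formNr form_alt -bal.
  by apply/eqP; ring.
rewrite /twist formC -/u -/w -[RHS](subrr (form (mul w a) (mul a' u'))) {1}E1.
rewrite -[mul a' u']bal' E2; ring.
Qed.

End TriangularChange.

(** The substitution is triangular because u'a' = - (u'b')b' lies in V4, as ua
    does.  Then l = m^2, and the factor l^3 m^5 of [triangular_twist] is
    m^11. *)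
Lemma balanced_twist a b a' b' : generators a b -> balanced a b ->
  balanced a' b' -> twist a b != 0 -> twist a' b' != 0 ->
  exists m, twist a' b' = m ^+ 11 * twist a b.
Proof.
move=> g bal bal' t0 t0'.
have [l [l' /= vV]] := gen1 g a'; have [n [m vV']] := gen1 g b'.
set v := a' - _ in vV; set v' := b' - _ in vV'.
have a'E : a' = l *: a + l' *: b + v by rewrite addrC subrK.
have b'E : b' = n *: a + m *: b + v' by rewrite addrC subrK.
clearbody v v'.
have noV4 x y : twist x y != 0 -> mul (mul x y) y \notin V4.
  apply: contra => xyV; rewrite /twist (orth45 fV) ?(mul4 fV) //.
  by rewrite (subvP (sub54 fV)) // (mul4 fV).
have wV := mod4_mul g l l' n m vV vV' n m vV'.
have uaV := mod4_mul g l l' n m vV vV' l l' vV.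
rewrite -a'E -b'E in wV uaV.
have d0 : l * m - l' * n != 0.
  apply: contraNneq (noV4 _ _ t0') => d0.
  by rewrite d0 mul0r scale0r subr0 in wV.
have l'0 : l' = 0.
  apply/eqP; apply: contraNT (noV4 _ _ t0) => l'0.
  have a'u'V : mul (mul a' b') a' \in V4.
    by rewrite saa_mulC -bal' memvN (mul3 fV) // (mul2 fV) // (mul1 fV).
  have := memvB a'u'V uaV; rewrite opprB addrC subrK rpredZeq.
  by rewrite (negbTE (mulf_neq0 d0 l'0)).
rewrite l'0 scale0r addr0 in a'E.
exists m; rewrite a'E b'E in bal' t0' |- *.
have := triangular_balanced g vV vV' bal bal'.
rewrite (triangular_twist g l n m vV vV') in t0' |- *.
move/eqP; rewrite mulf_eq0 (negbTE t0) orbF mulf_eq0 subr_eq0 => /orP[|/eqP <-].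
  by rewrite mulf_eq0 => /orP[]/eqP lm; rewrite lm expr0n ?mulr0 !mul0r eqxx in t0'.
congr (_ * _); ring.
Qed.
End Generators.

(** * Normalising the generators *)

Section Normalise.

Variables (F : fieldType) (L : saa F).
Variables (V2 V3 V4 V5 : {vspace L}).
Hypothesis fV : filtration V2 V3 V4 V5.
Implicit Types (x y z a b v : L).

Let gens := generators V2 V3 V4.

Lemma triangular_generators a b l n m v v' : gens a b ->
  l != 0 -> m != 0 -> v \in V2 -> v' \in V2 ->
  gens (l *: a + v) (n *: a + m *: b + v').
Proof.
move=> g l0 m0 vV vV'.
have uV := triangular_u fV a b l n m vV vV'.
have wV := triangular_w fV g l n m vV vV'.
split.
- move=> x; have [c [d xV]] := gen1 g x.
  exists ((c - d / m * n) / l), (d / m).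
  set c' := _ / l.
  have -> : x - (c' *: (l *: a + v) + d / m *: (n *: a + m *: b + v')) =
      x - (c *: a + d *: b) - c' *: v - (d / m) *: v'.
    by apply: form_inj => z; rewrite /c' !formE; field; apply/andP.
  by apply: memvB; [apply: memvB => //|]; apply: memvZ.
- move=> x xV; have [c cV] := gen2 g xV; exists (c / (l * m)).
  set u' := mul _ _ in uV *.
  have -> : x - (c / (l * m)) *: u' =
     x - c *: mul a b - (c / (l * m)) *: (u' - (l * m) *: mul a b).
    by apply: form_inj => z; rewrite !formE; field; apply/andP.
  by apply: memvB => //; apply: memvZ.
- move=> x xV; have [c cV] := gen3 g xV; exists (c / (l * m ^+ 2)).
  set w' := mul (mul _ _) _ in wV *.
  have -> : x - (c / (l * m ^+ 2)) *: w' = x - c *: mul (mul a b) b -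
      (c / (l * m ^+ 2)) *: (w' - (l * m ^+ 2) *: mul (mul a b) b).
    by apply: form_inj => z; rewrite !formE; field; apply/andP.
  by apply: memvB => //; apply: memvZ.
have := mod4_mul fV g l 0 n m vV vV' l 0 vV.
by rewrite mulr0 !scale0r subr0 !addr0.
Qed.

Lemma generators_nondeg a b x : gens a b ->
  form x a = 0 -> form x b = 0 -> form x (mul a b) = 0 ->
  form x (mul (mul a b) b) = 0 -> (forall y, y \in V4 -> form x y = 0) -> x = 0.
Proof.
move=> g xa xb xu xw x4; apply: form_nondeg => y.
have [c [d /(gen2 g)[k /(gen3 g)[m /x4]]]] := gen1 g y.
by rewrite !formE xa xb xu xw !mulr0 addr0 !subr0 => ->.
Qed.

(** If au = c (ub)a + d (ub)b modulo V5, then b + (c/d) a absorbs the first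
    term and a/d the remaining factor d. *)
Lemma balance_top a b c d : gens a b -> twist a b != 0 -> d != 0 ->
  mul a (mul a b) - (c *: mul (mul (mul a b) b) a + d *: mul (mul (mul a b) b) b) \in V5 ->
  exists a' b', [/\ gens a' b', twist a' b' != 0 &
    mul a' (mul a' b') - mul (mul (mul a' b') b') b' \in V5].
Proof.
move=> g t0 d0 auV.
have d'0 : d^-1 != 0 by rewrite invr_eq0.
have V20 := mem0v V2.
exists (d^-1 *: a + 0), ((d^-1 * c) *: a + 1 *: b + 0).
split.
- by apply: triangular_generators; rewrite ?oner_neq0.
- rewrite (triangular_twist fV g) // expr1n mulr1 mulf_neq0 // expf_neq0 //.
have := triangular_wx fV g d^-1 (d^-1 * c) 1 V20 V20 (d^-1 * c) 1 V20.
set a' := _ + 0; set b' := _ + 1 *: b + 0; set w' := mul (mul a' b') b' => w'V.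
have -> : mul a' (mul a' b') - mul w' b' = d ^- 2 *: (mul a (mul a b) -
    (c *: mul (mul (mul a b) b) a + d *: mul (mul (mul a b) b) b)) -
  (mul w' b' - (d^-1 * 1 ^+ 2) *: ((d^-1 * c) *: mul (mul (mul a b) b) a +
     1 *: mul (mul (mul a b) b) b)).
  apply: form_inj => z; rewrite {w'V}/w' /a' /b' !addr0 scale1r !mulE mul_alt ?mulE ?mul_alt ?mulE !formE.
  by field.
by apply: memvB => //; apply: memvZ.
Qed.

(** The defect au - (ub)b in V5 is orthogonal to V4, and to a, b and u because
    the trilinear form is alternating.  Only its value on w = ub is left; it
    is (au, w), and it is cancelled by adding a multiple of w to a. *)
Lemma balance a b : gens a b -> twist a b != 0 ->
  mul a (mul a b) - mul (mul (mul a b) b) b \in V5 ->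
  exists a', [/\ gens a' b, twist a' b != 0 & balanced a' b].
Proof.
move=> g t0 auV.
set u := mul a b in auV *; set w := mul u b in auV *.
(* replacing a by a + s w changes (au, w) by s (a (wb), w) = - s twist a b *)
pose s := tri a u w / twist a b.
have uV : u \in V2 by exact: (mul1 fV).
have wV : w \in V3 by exact: (mul2 fV).
have s54 x : x \in V5 -> x \in V4 by exact: (subvP (sub54 fV)).
have wbV : mul w b \in V4 by exact: (mul3 fV).
have qV : mul (mul w b) b \in V5 by exact: (mul4 fV).
have swV : s *: w \in V2 by rewrite memvZ // (subvP (sub32 fV)).
have E1 : 1 *: a + s *: w = a + s *: w by rewrite scale1r.
have E2 : 0 *: a + 1 *: b + 0 = b by rewrite scale0r add0r scale1r addr0.
have g' := triangular_generators 0 g (oner_neq0 F) (oner_neq0 F) swV (mem0v V2).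
have t' := triangular_twist fV g 1 0 1 swV (mem0v V2).
rewrite E1 E2 !expr1n !mul1r in g' t'.
exists (a + s *: w); split=> //; first by rewrite t'.
set a' := a + s *: w in g' *.
have u'E : mul a' b = u + s *: mul w b by rewrite /a' !mulE.
have w'E : mul (mul a' b) b = w + s *: mul (mul w b) b by rewrite u'E !mulE.
have DV : mul a' (mul a' b) - mul (mul (mul a' b) b) b \in V5.
  have -> : mul a' (mul a' b) - mul (mul (mul a' b) b) b =
      (mul a u - mul w b) + s *: mul w u - s *: mul (mul w b) a
      - (s ^+ 2) *: mul (mul w b) w - s *: mul (mul (mul w b) b) b.
    apply: form_inj => z; rewrite w'E u'E /a' !mulE.
    rewrite [mul a (mul w b)]saa_mulC [mul w (mul w b)]saa_mulC !formE; ring.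
  apply: memvB; last by apply: memvZ; apply: (mul4 fV); exact: s54.
  apply: memvB; last by apply: memvZ; exact: (mul4 fV).
  apply: memvB; last by apply: memvZ; exact: (mul4 fV).
  by apply: memvD => //; apply: memvZ; exact: (mul32 fV).
apply/eqP; rewrite eq_sym -subr_eq0; apply/eqP.
apply: (generators_nondeg g') => [|||| y yV]; last by rewrite formC (orth45 fV) ?oppr0.
- set u' := mul a' b; set w' := mul u' b.
  rewrite formDl formNl -[form (mul a' u') a']/(tri _ _ _) -[form (mul w' b) a']/(tri _ _ _).
  rewrite tri_alt [tri w' b a']tri_cycle tri_swap12 /tri -/u' formC.
  by rewrite -[form w' u']/(tri u' b u') tri_alt !oppr0 addr0.
- set u' := mul a' b; set w' := mul u' b.
  rewrite formDl formNl -[form (mul a' u') b]/(tri _ _ _) -[form (mul w' b) b]/(tri _ _ _).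
  by rewrite tri_alt tri_swap23 /tri -/u' form_alt !oppr0 addr0.
- set u' := mul a' b; set w' := mul u' b.
  rewrite formDl formNl -[form (mul a' u') u']/(tri _ _ _) -[form (mul w' b) u']/(tri _ _ _).
  by rewrite tri_alt -tri_cycle tri_swap23 /tri -/w' form_alt !oppr0 addr0.
rewrite !formE -/(tri _ _ _) -[form (mul _ b) _]/(tri _ _ _) tri_alt subr0.
  rewrite w'E u'E /a' /tri !mulE !formE -/(tri _ _ _).
  have -> : form (mul a u) (mul (mul w b) b) = 0.
    by apply: (orth45 fV) => //; rewrite saa_mulC memvN; exact: (gen4 g).
  have -> : form (mul a (mul w b)) (mul (mul w b) b) = 0.
    by rewrite -/(tri _ _ _) tri_cycle (tri_44 fV) // s54.
  have -> : form (mul w u) (mul (mul w b) b) = 0.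
    by apply: (orth45 fV) => //; apply: s54; exact: (mul32 fV).
  have -> : form (mul w (mul w b)) (mul (mul w b) b) = 0.
    by rewrite -/(tri _ _ _) tri_cycle (tri_44 fV) // s54.
  have -> : form (mul a (mul w b)) w = - twist a b.
    by rewrite -/(tri _ _ _) -tri_cycle /tri -formC.
  rewrite -!/(tri _ _ _) !tri_alt /s; field; exact: t0.
Qed.

Lemma central_prod a b x y : gens a b -> x \in V5 -> y \in V2 ->
  forall t, mul (mul x y) t = 0.
Proof.
move=> g xV yV t; apply: form_nondeg => s.
rewrite -/(tri _ _ _) tri_cycle /tri form_mulr tri_cycle /tri formC.
rewrite (orth45 fV) ?oppr0 ?(subvP (sub54 fV)) //.
by apply: (mul22 fV g) => //; exact: (mul1 fV).
Qed.

(** Scaling a by k^2 and b by k multiplies the twist by k^11, so for k equal to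
    the twist itself the result is the square of k^6.  The generators then
    become orthogonal by adding to a an element of the center that pairs
    nontrivially with b. *)
Lemma normal_generators a b : gens a b -> twist a b != 0 -> balanced a b ->
  exists a' b' r, [/\ r != 0, form a' b' = 0, balanced a' b' & twist a' b' = r ^+ 2].
Proof.
move=> g t0 bal; set k := twist a b.
pose a1 := k ^+ 2 *: a; pose b1 := k *: b.
have bal1 : balanced a1 b1.
  rewrite /balanced /a1 /b1 !mulE bal !scalerA; congr (_ *: _); ring.
have t1 : twist a1 b1 = (k ^+ 6) ^+ 2.
  rewrite -[RHS](_ : k ^+ 11 * twist a b = _); last by rewrite -/k; ring.
  by rewrite /twist /a1 /b1 !mulE !formE; ring.
have k0 : k ^+ 6 != 0 by rewrite expf_neq0.
set u := mul a b; set w := mul u b.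
pose z0 := mul (mul (mul w b) a) u.
have z0b : form z0 b = - k.
  by rewrite -[LHS]/(tri (mul (mul w b) a) u b) tri_cycle /tri formC -/(tri (mul w b) a w)
    tri_cycle /tri saa_mulC formNl -formC.
pose z := (form a1 b1 / k ^+ 2) *: z0.
have zb : form z b1 = - form a1 b1.
  by rewrite formZl [form z0 b1]formZr z0b; field.
have zl t : mul z t = 0.
  rewrite /z saa_mulZl (central_prod g) ?scaler0 //; last exact: (mul1 fV).
  by apply/(mul4 fV)/(mul3 fV)/(mul2 fV)/(mul1 fV).
have zr t : mul t z = 0 by rewrite saa_mulC zl oppr0.
exists (a1 + z), b1, (k ^+ 6); split=> //.
- by rewrite formDl zb subrr.
- by rewrite /balanced saa_mulDl zl addr0 bal1 saa_mulDl zl addr0.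
by rewrite /twist [mul (a1 + z) b1]saa_mulDl zl addr0 saa_mulDr zr addr0.
Qed.

End Normalise.

(** * The lower central series in class 7 *)

Section Powers.

Variables (F : fieldType) (L : saa F).
Implicit Types (x y z a b v : L).

Lemma powerS m : saa_power L m.+2 = saa_prodv (saa_power L m.+1) fullv.
Proof. by []. Qed.

Lemma power_mul m x y : x \in saa_power L m.+1 -> mul x y \in saa_power L m.+2.
Proof. by move=> xV; apply: prodv_mem; rewrite ?memvf. Qed.

Lemma power_sub m : (saa_power L m.+2 <= saa_power L m.+1)%VS.
Proof.
elim: m => [|m IH]; first exact: subvf.
by apply/saa_prodvP => u v /(subvP IH) uV _; apply: power_mul.
Qed.

(** Once two consecutive powers agree all later ones do, so no power before the
    class is reached can be stationary. *)
Lemma power_dim_decr c m : nilpotent_class L c -> (m < c)%N ->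
  (\dim (saa_power L m.+2) < \dim (saa_power L m.+1))%N.
Proof.
move=> [c0 nz] mc; rewrite ltnNge (geq_leqif (dimv_leqif_sup (power_sub m))).
apply/negP => sub; case: (nz m mc).
have eqm : saa_power L m.+1 = saa_power L m.+2.
  by apply/eqP; rewrite eqEsubv sub power_sub.
have stable k : saa_power L (k + m).+2 = saa_power L m.+2.
  by elim: k => // k IH; rewrite addSn powerS IH -eqm.
have cE : ((c - m.+1) + m).+1 = c by rewrite -addnS subnK.
by rewrite eqm -(stable (c - m.+1)%N) cE.
Qed.

(** Moving factors across the form turns (L^(i+1), L^(j+1)) into
    (L^(c+1), L) = 0. *)
Lemma power_orth c i j : saa_power L c.+1 = 0%VS -> (i + j = c)%N ->
  orth (saa_power L i.+1) (saa_power L j.+1).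
Proof.
move=> c0; elim: j i => [|j IH] i ijc.
  rewrite addn0 in ijc; rewrite ijc c0.
  by move=> x y; rewrite memv0 => /eqP-> _; rewrite form0l.
by apply: orth_prodv; apply: (IH i.+1); rewrite addSn -addnS.
Qed.

Section ClassSeven.

Hypotheses (dL : \dim {:L} = 10%N) (c7 : nilpotent_class L 7).
Hypothesis L43 : saa_prodv (saa_power L 4) (saa_power L 3) = saa_power L 7.

Let L2 := saa_power L 2.
Let L3 := saa_power L 3.
Let L4 := saa_power L 4.
Let L5 := saa_power L 5.

Let m1 x y : mul x y \in L2. Proof. exact: (@power_mul 0) (memvf x). Qed.
Let m2 x y : x \in L2 -> mul x y \in L3. Proof. exact: power_mul. Qed.
Let m3 x y : x \in L3 -> mul x y \in L4. Proof. exact: power_mul. Qed.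
Let m4 x y : x \in L4 -> mul x y \in L5. Proof. exact: power_mul. Qed.
Let s54 x : x \in L5 -> x \in L4. Proof. exact: subvP (power_sub 3) x. Qed.

Let o (i j : nat) : (i + j = 7)%N -> orth (saa_power L i.+1) (saa_power L j.+1).
Proof. exact: power_orth c7.1. Qed.

Lemma power43_not_orth : exists p q t, [/\ p \in L4, q \in L3 & tri p q t != 0].
Proof.
have [|p [q [pV qV]]] := @prodv_neq0 _ _ L4 L3.
  by rewrite L43; apply/eqP; exact: (c7.2 6%N).
by move/form_neq0 => [t pqt]; exists p, q, t.
Qed.

(** L^5 is not orthogonal to L^3, because (L^4 L, L^3) = (L^4 L^3, L). *)
Lemma power5_not_orth : exists g u b, [/\ g \in L5, u \in L2 & form g (mul u b) != 0].
Proof.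
have [p [q [t [pV qV pqt]]]] := power43_not_orth.
have [|u [b [uV _ gub]]] := @prodv_not_orth _ _ L2 fullv (mul p t) q qV.
  by rewrite -[form _ _]/(tri p t q) tri_swap23 oppr_eq0.
by exists (mul p t), u, b; split=> //; exact: m4.
Qed.

(** The elements g of L^5 and h = bg of L^6 do not annihilate L^3 and L^2, so
    there are x, y with (h, xy) nonzero, and hx, hy are independent elements of
    L^7.  Hence L^7 has dimension at least 2, and each earlier power has a
    larger dimension than the next.  The orthogonality relations give upper
    bounds.  Only L^4 could still have dimension 5, but it is not isotropic,
    whereas its subspace L^5 is orthogonal to it. *)
Lemma power_dims : [/\ \dim L2 = 8%N, \dim L3 = 7%N, \dim L4 = 6%N & \dim L5 = 4%N].
Proof.
have [g [u [b [gV uV gub]]]] := power5_not_orth.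
pose h := mul b g.
have hV : h \in saa_power L 6.
  by rewrite /h saa_mulC memvN; exact: power_mul.
have hu : form h u != 0.
  by rewrite -[form h u]/(tri b g u) -tri_cycle -/(tri u b g) /tri formC oppr_eq0.
have [x [y [_ _ hxy]]] := @prodv_not_orth _ _ fullv fullv h u uV hu.
have hyx : form (mul h x) y != 0.
  by move: hxy; rewrite form_mulr oppr_eq0 -tri_cycle.
have d7 : (1 < \dim (saa_power L 7))%N.
  have hx7 : mul h x \in saa_power L 7 by exact: power_mul.
  have hy7 : mul h y \in saa_power L 7 by exact: power_mul.
  have hy0 : mul h y != 0.
    apply: contraNneq hyx => hy0; rewrite -[form _ _]/(tri h x y) tri_swap23 /tri hy0.
    by rewrite form0l oppr0.
  have := @dimv_proper _ _ <[mul h y]>%VS (saa_power L 7) (mul h x).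
  rewrite dim_vline hy0 -memvE; apply=> //.
  apply: contra hyx => /vlineP[k ->].
  by rewrite formZl -[form _ _]/(tri h y y) tri_alt mulr0.
have d6 := leq_ltn_trans d7 (power_dim_decr c7 (isT : 5 < 7)%N).
have d5 := leq_ltn_trans d6 (power_dim_decr c7 (isT : 4 < 7)%N).
have d3' := power_dim_decr c7 (isT : 2 < 7)%N.
have d2' := power_dim_decr c7 (isT : 1 < 7)%N.
have u27 := orth_dim (@o 1 6 erefl).
have u36 := orth_dim (@o 2 5 erefl).
have u45 := orth_dim (@o 3 4 erefl).
rewrite dL in u27 u36 u45.
have d45 : (\dim L5 + 2 <= \dim L4)%N.
  have [p [q [t [pV qV pqt]]]] := power43_not_orth.
  have qtV : mul q t \in L4 by exact: m3.
  have pqt' : form (mul q t) p != 0 by rewrite -[form _ _]/(tri q t p) -tri_cycle.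
  rewrite leqNgt addnS addn1 ltnS; apply/negP => small.
  have pV5 : p \notin L5.
    by apply: contra pqt' => pV5; rewrite (@o 3 4 erefl).
  have [k] := codim1 (power_sub 3) small pV pV5 qtV.
  move/(@o 3 4 erefl _ _ pV); rewrite !formE form_alt mulr0 subr0 => pqt0.
  by rewrite formC pqt0 oppr0 eqxx in pqt'.
rewrite -/L2 -/L3 -/L4 -/L5 in d6 d5 d3' d2' u27 u36 u45 *.
split; lia.
Qed.

(** L^5 is the whole of the orthogonal complement of L^4, by dimension. *)
Lemma perp_power4 x : (forall y, y \in L4 -> form y x = 0) -> x \in L5.
Proof.
move=> x4; apply: contraT => x5; have [_ _ d4 d5] := power_dims.
have : orth (L5 + <[x]>) L4.
  move=> _ y /memv_addP[z zV [_ /vlineP[k ->] ->]] yV.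
  by rewrite formDl formZl (@o 4 3 erefl) // formC x4 // oppr0 mulr0 addr0.
by move/orth_dim; rewrite d4 dL dim_addv_line // d5.
Qed.

Lemma power_filtration : filtration L2 L3 L4 L5.
Proof.
split=> //; try exact: power_sub.
  move=> x y xV yV; apply: perp_power4 => z zV.
  rewrite form_mulr -tri_cycle /tri (@o 6 1 erefl) ?oppr0 // -L43.
  exact: prodv_mem.
exact: (@o 3 4 erefl).
Qed.

Let fV := power_filtration.
Let gens := generators L2 L3 L4.

(** An element g of L^5 induces a functional on L^3/L^4.  Some x -> (g, ux) is
    nonzero at b; subtracting a multiple of b from any c outside L^2 + <b>
    gives an element a at which it vanishes. *)
Lemma power_generators : exists a b, gens a b.
Proof.
have [d2 d3 d4 d5] := power_dims.
have [g [u [b [gV uV gub]]]] := power5_not_orth.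
have o54 x : x \in L4 -> form g x = 0 by move=> xV; apply: (@o 4 3 erefl).
have o55 x : x \in L5 -> form g x = 0 by move/s54; exact: o54.
have u3 : u \notin L3.
  by apply: contra gub => u3; rewrite o54 // m3.
have b2 : b \notin L2.
  apply: contra gub => bV.
  have [|k kV] := codim1 (power_sub 1) _ uV u3 bV; first by rewrite d2 d3.
  have -> : mul u b = - mul (b - k *: u) u.
    by rewrite !mulE mul_alt scaler0 oppr0 addr0 -saa_mulC.
  by rewrite formNr o55 ?oppr0 // (mul32 fV).
have d2b : \dim (L2 + <[b]>) = 9%N by rewrite dim_addv_line // d2.
have /subvPn[c _ c2] : ~~ ({:L} <= L2 + <[b]>)%VS.
  by apply/negP => /dimvS; rewrite dL d2b.
pose a := c - (form g (mul u c) / form g (mul u b)) *: b.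
have a2 : a \notin (L2 + <[b]>)%VS.
  apply: contra c2 => a2; rewrite -(subrK ((form g (mul u c) / form g (mul u b)) *: b) c).
  by rewrite memvD // memvZ // mem_addv_line.
have G1 x : exists c d, x - (c *: a + d *: b) \in L2.
  have [|k xV] := codim1 (subvf (L2 + <[b]>)) _ (memvf a) a2 (memvf x); first by rewrite dL d2b.
  have [|m mV] := codim1 (addvSl L2 <[b]>) _ (mem_addv_line _ _) b2 xV.
    by rewrite d2b d2.
  by exists k, m; rewrite opprD addrA.
have ab3 : mul a b \notin L3.
  apply: contra u3 => abV; move: (u) uV; apply/subvP/saa_prodvP => x y _ _.
  have [k1 [k2 xV]] := G1 x; have [k3 [k4 yV]] := G1 y.
  have := mod3_mul fV a b k1 k2 k3 k4 xV yV.
  rewrite ![_ + (_ - _)]addrC !subrK => xyV.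
  by rewrite -(subrK ((k1 * k4 - k2 * k3) *: mul a b) (mul x y)) memvD // memvZ.
have G2 x : x \in L2 -> exists c, x - c *: mul a b \in L3.
  by apply: (codim1 (power_sub 1)) => //; rewrite d2 d3.
have [k kV] := G2 u uV.
have gk x : form g (mul u x) = k * form g (mul (mul a b) x).
  apply/eqP; rewrite -subr_eq0 -formZr -saa_mulZl -formNr -formDr -saa_mulNl -saa_mulDl.
  by rewrite o54 // m3.
have gabb : form g (mul (mul a b) b) != 0.
  by apply: contraNneq gub => gab; rewrite gk gab mulr0.
have gaba : form g (mul (mul a b) a) = 0.
  have : form g (mul u a) = 0 by rewrite /a !mulE !formE; field.
  rewrite gk => /eqP; rewrite mulf_eq0 => /orP[/eqP k0|/eqP//].
  by rewrite gk k0 mul0r eqxx in gub.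
have w4 : mul (mul a b) b \notin L4.
  by apply: contra gabb => wV; rewrite o54.
have G3 x : x \in L3 -> exists c, x - c *: mul (mul a b) b \in L4.
  by apply: (codim1 (power_sub 2)) => //; [rewrite d3 d4 | exact: m2].
exists a, b; split=> //.
have [m mV] := G3 _ (m2 a (m1 a b)).
have /eqP := o54 _ mV; rewrite !formE gaba add0r oppr_eq0 mulf_eq0.
rewrite (negbTE gabb) orbF => /eqP m0.
by rewrite m0 scale0r subr0 in mV.
Qed.

Section PowerGenerators.

Variables a b : L.
Hypothesis g : gens a b.
Let u := mul a b.
Let w := mul u b.

Let uV : u \in L2. Proof. exact: m1. Qed.
Let wV : w \in L3. Proof. exact: m2. Qed.
Let wxV x : mul w x \in L4. Proof. exact: m3. Qed.

Lemma power4_span x : x \in L4 ->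
  exists c d, x - (c *: mul w a + d *: mul w b) \in L5.
Proof.
suff /subvP sub : (L4 <= <[mul w a]> + <[mul w b]> + L5)%VS.
  case/sub/memv_addP => _ /memv_addP[_ /vlineP[c ->] [_ /vlineP[d ->] ->]] [y yV ->].
  by exists c, d; rewrite addrC addKr.
apply/saa_prodvP => y z yV _.
have [k] := gen3 g yV; set v := y - _ => vV.
have [c [d]] := gen1 g z; set t := z - _ => tV.
have -> : mul y z = (k * c) *: mul w a + (k * d) *: mul w b + (k *: mul w t + mul v z).
  by apply: form_inj => s; rewrite /v /t !mulE !formE -/u -/w; ring.
apply: memv_add; first by apply: memv_add; rewrite memvZ ?memv_line.
by rewrite memvD ?m4 // memvZ // (mul32 fV).
Qed.

(** Modulo L^5, which is orthogonal to L^4, the space L^4 is spanned by (ub)a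
    and (ub)b.  If these were orthogonal, L^4 would be isotropic. *)
Lemma power_twist : twist a b != 0.
Proof.
have [p [q [t [pV qV]]]] := power43_not_orth.
rewrite tri_cycle /tri.
apply: contra_neq => t0.
have [c [d]] := power4_span pV; set p5 := p - _ => p5V.
have [c' [d']] := power4_span (m3 t qV); set q5 := _ - _ => q5V.
have pE : p = c *: mul w a + d *: mul w b + p5 by rewrite addrC subrK.
have qE : mul q t = c' *: mul w a + d' *: mul w b + q5 by rewrite addrC subrK.
clearbody p5 q5; rewrite {}pE {}qE.
have o45 x y := orth45 fV (x := x) (y := y).
rewrite !formE !form_alt ![form (mul w _) p5]o45 // ![form q5 _]formC ![form _ q5]o45 //.
  rewrite [form (mul w a) _]formC -[form (mul w b) _]/(twist a b) t0; ring.
exact: s54.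
Qed.

(** Put w = ub.  If d were 0, then (ua, wa) = 0.  An element of U is orthogonal
    to wa, hence lies in <wa> + L^5, and its products with L^2 are then
    orthogonal to L^2 + <a>.  This space has dimension 9, so U L^2 would have
    dimension at most 1. *)
Lemma power_top :
  (let U := (L4 :&: saa_transp L3 (saa_prodv L5 L2))%VS in
   \dim (saa_prodv U L2) = 2%N) ->
  exists c d, d != 0 /\ mul a u - (c *: mul w a + d *: mul w b) \in L5.
Proof.
move=> /=; set U := (L4 :&: _)%VS => dU.
have uaV : mul u a \in L4 by exact: gen4 g.
have [c [d auV]] : exists c d, mul a u - (c *: mul w a + d *: mul w b) \in L5.
  by apply: power4_span; rewrite saa_mulC memvN.
exists c, d; split=> //; apply/eqP => d0; rewrite d0 scale0r addr0 in auV.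
have o45 x y := orth45 fV (x := x) (y := y).
have [d2 _ _ _] := power_dims.
have a2 : a \notin L2.
  apply: contra power_twist => aV; apply/eqP; apply: o45; first exact: wxV.
  exact: (mul32 fV).
have tri5 x y : x \in L5 -> y \in L2 -> tri x y a = 0.
  move=> xV yV; have [k kV] := gen2 g yV.
  rewrite tri_cycle -(subrK (k *: u) y) /tri saa_mulDl saa_mulZl o45 //.
  by rewrite memvD ?memvZ // m3.
have xwa x : x \in U -> form x (mul w a) = 0.
  rewrite memv_cap => /andP[_ /saa_transpP/(_ w wV) xw].
  rewrite form_mulr -tri_cycle; apply/eqP; rewrite oppr_eq0; apply: contraT.
  rewrite -[tri x w a]/(form (mul x w) a) formC oppr_eq0 => nz.
  have [s [t [sV tV]]] := prodv_not_orth xw nz.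
  by rewrite form_mulr tri5 // oppr0 eqxx.
have : orth (L2 + <[a]>) (saa_prodv U L2).
  move=> y x yV xV; apply/eqP; apply: contraT => nz.
  have [s [t [sU tV]]] := prodv_not_orth xV nz; rewrite form_mulr oppr_eq0.
  have sV : s \in L4 by move: sU; rewrite memv_cap => /andP[].
  case/memv_addP: yV => y2 y2V [_ /vlineP[k ->] ->].
  rewrite /tri formDr formZr -!/(tri _ _ _).
  have -> : tri s t y2 = 0.
    by rewrite tri_cycle /tri formC o45 ?oppr0 // (mul22 fV g).
  suff -> : tri s t a = 0 by rewrite mulr0 addr0 eqxx.
  have [c1 [c2]] := power4_span sV; set s5 := s - _ => s5V.
  have sE : s = c1 *: mul w a + c2 *: mul w b + s5 by rewrite addrC subrK.
  clearbody s5; have c20 : c2 = 0.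
    have := xwa _ sU; rewrite sE !formE form_alt [form s5 _]formC [form _ s5]o45 // oppr0 mulr0 add0r addr0.
    by move/eqP; rewrite mulf_eq0 (negbTE power_twist) orbF => /eqP.
  have [k1] := gen2 g tV; set t3 := t - _ => t3V.
  have [k2] := gen3 g t3V; set t4 := t3 - _ => t4V.
  have tE : t = k1 *: u + k2 *: w + t4.
    by apply: form_inj => z; rewrite /t4 /t3 !formE; ring.
  clearbody t4; rewrite sE c20 scale0r addr0 /tri saa_mulDl formDl -!/(tri _ _ _) [tri s5 t a]tri5 // addr0.
  rewrite tE /tri !mulE !formE -!/(tri _ _ _).
  have -> : tri (mul w a) u a = 0.
    rewrite tri_cycle tri_swap12 /tri formC.
    have := o45 _ _ (wxV a) auV; rewrite !formE form_alt mulr0 subr0 => ->.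
    by rewrite !oppr0.
  have -> : tri (mul w a) w a = 0 by rewrite tri_cycle /tri form_alt.
  have -> : tri (mul w a) t4 a = 0.
    by rewrite tri_cycle /tri formC o45 ?oppr0 // m4.
  ring.
by move/orth_dim; rewrite dL dU dim_addv_line // d2.
Qed.

End PowerGenerators.

Theorem class7_given_by :
  (let U := (L4 :&: saa_transp L3 (saa_prodv L5 L2))%VS in
   \dim (saa_prodv U L2) = 2%N) ->
  exists r : F, r != 0 /\ given_by L (P10_2_4 r).
Proof.
move=> dU; have [a [b g]] := power_generators.
have [c [d [d0 auV]]] := power_top g dU.
have [a1 [b1 [g1 t1 auV1]]] := balance_top fV g (power_twist g) d0 auV.
have [a2 [g2 t2 bal2]] := balance fV g1 t1 auV1.
have [a3 [b3 [r [r0 ab bal tw]]]] := normal_generators fV g2 t2 bal2.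
by exists r; split=> //; exact: (given_by_P10_2_4 fV dL r0 ab bal tw).
Qed.

End ClassSeven.
End Powers.

(** * The weight filtration of a presented algebra *)

Lemma bidx_cases (Q : bidx -> Prop) :
  (forall k, (0 < k <= 5)%N -> Q (bx k)) -> (forall k, (0 < k <= 5)%N -> Q (by_ k)) ->
  forall a, Q a.
Proof.
move=> Qx Qy [i|i].
  by have := Qx i.+1; rewrite /bx /= inord_val; apply; exact: ltn_ord.
by have := Qy i.+1; rewrite /by_ /= inord_val; apply; exact: ltn_ord.
Qed.

Lemma weight_dual a : (weight a + weight (dual a) = 8)%N.
Proof. by case: a => i; ord5 i. Qed.

Lemma weight_unlisted a b c :
  (8 < weight a + weight b + weight c)%N -> unlisted a b c.
Proof.
move=> big; apply/allP => t tS; apply/negP => pt; move: big; rewrite ltnNge => /negP; apply.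
pose wt := nth 0%N [:: 4; 5; 6; 7; 7; 4; 3; 2; 1; 1]%N.
have -> : (weight a + weight b + weight c = sumn (map wt [:: code a; code b; code c]))%N.
  by rewrite /= addn0 addnA.
rewrite (perm_sumn (perm_map wt pt)).
by move: t tS {pt}; apply/allP.
Qed.

Section WeightFiltration.

Variables (F : fieldType) (L : saa F) (r : F) (e : bidx -> L).
Hypothesis se : standard_basis e.

Let eg := std_gram se.

Lemma basis_nondeg x : (forall a, form x (e a) = 0) -> x = 0.
Proof.
move=> x0; apply: form_nondeg => y; have [/span_basis be _ _ _] := se.
suff /subvP/(_ y) : (<<codom e>> <= perp1 x)%VS.
  by rewrite be memvf mem_perp1 => /(_ isT)/eqP.
by apply/span_subvP => _ /codomP[a ->]; rewrite mem_perp1 x0.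
Qed.

Definition coeff (a : bidx) (x : L) := gram F a (dual a) * form x (e (dual a)).

Lemma basis_expand x : x = \sum_a coeff a x *: e a.
Proof.
apply/eqP; rewrite -subr_eq0; apply/eqP/basis_nondeg => b.
rewrite formDl formNl linear_sumlz (bigD1 (dual b)) //= big1 => [|a ab].
  have := gram_dual_sqr F (dual b); rewrite dualK => gg.
  by rewrite addr0 formZl /coeff eg dualK mulrAC gg mul1r subrr.
by rewrite formZl eg gram_eq0 ?mulr0 // eq_sym (can2_eq dualK dualK).
Qed.

Definition weight_space (m : nat) : {vspace L} :=
  (\bigcap_(a | (8 < weight a + m)%N) perp1 (e a))%VS.

Lemma weight_spaceP m x :
  reflect (forall a, (8 < weight a + m)%N -> form (e a) x = 0) (x \in weight_space m).
Proof.
rewrite memvE; apply: (iffP subv_bigcapP) => xm a am.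
  by apply/eqP; rewrite -mem_perp1 memvE xm.
by rewrite -memvE mem_perp1 xm.
Qed.

Lemma coeff_weight m x a : x \in weight_space m -> (weight a < m)%N -> coeff a x = 0.
Proof.
move=> /weight_spaceP xm am; rewrite /coeff formC xm ?oppr0 ?mulr0 //.
have := weight_dual a; lia.
Qed.

Lemma weight_space_orth m n : (8 < m + n)%N ->
  orth (weight_space m) (weight_space n).
Proof.
move=> mn x y xm /weight_spaceP yn; rewrite (basis_expand x) linear_sumlz big1 // => a _.
rewrite formZl; case: (ltnP (weight a) m) => am.
  by rewrite (coeff_weight xm) ?mul0r.
by rewrite yn ?mulr0 //; lia.
Qed.

Hypothesis unl : forall a b c, unlisted a b c -> tri (e a) (e b) (e c) = 0.

Lemma weight_space_mul m n x y :
  x \in weight_space m -> y \in weight_space n -> mul x y \in weight_space (m + n).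
Proof.
move=> xm yn; apply/weight_spaceP => c cmn.
rewrite formC (basis_expand x) linear_sumlz linear_sumlz big1 ?oppr0 // => a _.
rewrite saa_mulZl formZl; case: (ltnP (weight a) m) => am.
  by rewrite (coeff_weight xm) ?mul0r.
rewrite (basis_expand y) linear_sumr linear_sumlz big1 ?mulr0 // => b _.
rewrite saa_mulZr formZl; case: (ltnP (weight b) n) => bn.
  by rewrite (coeff_weight yn) ?mul0r.
by rewrite -/(tri _ _ _) unl ?mulr0 // weight_unlisted //; lia.
Qed.

Lemma weight_space_full x : x \in weight_space 1.
Proof. by apply/weight_spaceP => -[i|i]; ord5 i. Qed.

Lemma weight_space_sub m n x : (m <= n)%N -> x \in weight_space n -> x \in weight_space m.
Proof. by move=> mn /weight_spaceP xn; apply/weight_spaceP => a am; apply: xn; lia. Qed.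

Lemma weight_filtration :
  filtration (weight_space 2) (weight_space 3) (weight_space 4) (weight_space 5).
Proof.
split.
- by apply/subvP => x; apply: weight_space_sub.
- by apply/subvP => x; apply: weight_space_sub.
- by apply/subvP => x; apply: weight_space_sub.
- by move=> x y; exact: weight_space_mul (weight_space_full x) (weight_space_full y).
- by move=> x y xV; exact: weight_space_mul xV (weight_space_full y).
- by move=> x y xV; exact: weight_space_mul xV (weight_space_full y).
- by move=> x y xV; exact: weight_space_mul xV (weight_space_full y).
- by move=> x y xV yV; exact: weight_space_mul xV yV.
exact: weight_space_orth.
Qed.

End WeightFiltration.

(** * The parameter up to eleventh powers *)

Section GivenBy.

Variables (F : fieldType) (L : saa F) (r : F) (e : bidx -> L).
Hypothesis se : standard_basis e.
Hypothesis lis : forall a b c s, (a, b, c, s) \in P10_2_4 r -> tri (e a) (e b) (e c) = s.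
Hypothesis unl : forall a b c, unlisted a b c -> tri (e a) (e b) (e c) = 0.

Let fxy i j : (0 < i <= 5)%N -> (0 < j <= 5)%N -> form (e (bx i)) (e (by_ j)) = (i == j)%:R.
Proof.
case: i j => // i [] // j iP jP; have [_ _ _ ->] := se.
by rewrite -val_eqE /= !inordK.
Qed.
Let fyx i j : (0 < i <= 5)%N -> (0 < j <= 5)%N -> form (e (by_ i)) (e (bx j)) = - (i == j)%:R.
Proof. by move=> iP jP; rewrite formC fxy // eq_sym. Qed.
Let fxx i j : form (e (bx i)) (e (bx j)) = 0.
Proof. by have [_ -> _ _] := se. Qed.
Let fyy i j : form (e (by_ i)) (e (by_ j)) = 0.
Proof. by have [_ _ -> _] := se. Qed.

Let l1 : tri (e (bx 3)) (e (by_ 4)) (e (by_ 5)) = r. Proof. by apply: lis; rewrite !inE eqxx. Qed.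
Let l2 : tri (e (bx 2)) (e (by_ 3)) (e (by_ 5)) = 1. Proof. by apply: lis; rewrite !inE eqxx ?orbT. Qed.
Let l3 : tri (e (bx 1)) (e (by_ 2)) (e (by_ 5)) = 1. Proof. by apply: lis; rewrite !inE eqxx ?orbT. Qed.
Let l4 : tri (e (bx 1)) (e (by_ 3)) (e (by_ 4)) = 1. Proof. by apply: lis; rewrite !inE eqxx ?orbT. Qed.
Let l5 : tri (e (by_ 1)) (e (by_ 2)) (e (by_ 4)) = 1. Proof. by apply: lis; rewrite !inE eqxx ?orbT. Qed.

Let eq_basis x y : (forall a, form x (e a) = form y (e a)) -> x = y.
Proof.
move=> xy; apply/eqP; rewrite -subr_eq0; apply/eqP/(basis_nondeg se) => a.
by rewrite formDl formNl xy subrr.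
Qed.

Let c1 k : (0 < k <= 5)%N -> [\/ k = 1, k = 2, k = 3 | k = 4 \/ k = 5]%N.
Proof. by case: k => [|[|[|[|[|[|k]]]]]] // _; constructor; auto. Qed.

Ltac unlist := rewrite -[LHS]/(tri _ _ _) unl ?formE ?fxx ?fyy ?fxy ?fyx ?oppr0 ?mulr0 //;
  rewrite /unlisted ?code_bx ?code_by.

Lemma basis_y4y5 : mul (e (by_ 4)) (e (by_ 5)) = - r *: e (by_ 3).
Proof.
apply: eq_basis; apply: bidx_cases => k /c1[->|->|->|[->|->]]; try by unlist.
by rewrite -[LHS]/(tri _ _ _) -tri_cycle l1 formZl fyx //= mulrNN mulr1.
Qed.

Lemma basis_y3y5 : mul (e (by_ 3)) (e (by_ 5)) = - e (by_ 2).
Proof.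
apply: eq_basis; apply: bidx_cases => k /c1[->|->|->|[->|->]]; try by unlist.
by rewrite -[LHS]/(tri _ _ _) -tri_cycle l2 ?formNl ?fyx ?fxy //= opprK.
Qed.

Lemma basis_y2y5 : mul (e (by_ 2)) (e (by_ 5)) = - e (by_ 1).
Proof.
apply: eq_basis; apply: bidx_cases => k /c1[->|->|->|[->|->]]; try by unlist.
by rewrite -[LHS]/(tri _ _ _) -tri_cycle l3 ?formNl ?fyx ?fxy //= opprK.
Qed.

Lemma basis_y3y4 : mul (e (by_ 3)) (e (by_ 4)) = - e (by_ 1).
Proof.
apply: eq_basis; apply: bidx_cases => k /c1[->|->|->|[->|->]]; try by unlist.
by rewrite -[LHS]/(tri _ _ _) -tri_cycle l4 ?formNl ?fyx ?fxy //= opprK.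
Qed.

Lemma basis_y2y4 : mul (e (by_ 2)) (e (by_ 4)) = e (bx 1).
Proof.
apply: eq_basis; apply: bidx_cases => k /c1[->|->|->|[->|->]]; try by unlist.
by rewrite -[LHS]/(tri _ _ _) -tri_cycle l5 ?formNl ?fyx ?fxy //=.
Qed.

Let u := mul (e (by_ 4)) (e (by_ 5)).

Let wE : mul u (e (by_ 5)) = r *: e (by_ 2).
Proof. by rewrite /u basis_y4y5 saa_mulZl basis_y3y5 scaleNr scalerN opprK. Qed.

Let uaE : mul u (e (by_ 4)) = r *: e (by_ 1).
Proof. by rewrite /u basis_y4y5 saa_mulZl basis_y3y4 scaleNr scalerN opprK. Qed.

(** For a = y_4 and b = y_5 one has u = - r y_3, ub = r y_2, (ub)b = - r y_1
    and ua = r y_1. *)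
Lemma basis_balanced : balanced (e (by_ 4)) (e (by_ 5)).
Proof.
by rewrite /balanced -/u wE saa_mulZl basis_y2y5 scalerN -uaE -saa_mulC.
Qed.

Lemma basis_twist : twist (e (by_ 4)) (e (by_ 5)) = r ^+ 2.
Proof.
by rewrite /twist -/u wE !saa_mulZl basis_y2y5 basis_y2y4 !formE fyx //=; ring.
Qed.

Lemma basis_generators : r != 0 ->
  generators (weight_space e 2) (weight_space e 3) (weight_space e 4)
    (e (by_ 4)) (e (by_ 5)).
Proof.
move=> r0.
have wx k : (0 < k <= 5)%N -> weight (bx k) = nth 0%N [:: 0; 4; 5; 6; 7; 7]%N k.
  by move=> kP; rewrite /weight code_bx //; case/c1: kP => [->|->|->|[->|->]].
have wy k : (0 < k <= 5)%N -> weight (by_ k) = nth 0%N [:: 0; 4; 3; 2; 1; 1]%N k.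
  by move=> kP; rewrite /weight code_by //; case/c1: kP => [->|->|->|[->|->]].
split.
- move=> x; exists (form (e (bx 4)) x), (form (e (bx 5)) x).
  apply/weight_spaceP; apply: bidx_cases => k kP; rewrite ?wx ?wy //;
    case/c1: kP => [->|->|->|[->|->]] // _; rewrite !formE !fxy //=; ring.
- move=> x /weight_spaceP xV; exists (- form (e (bx 3)) x / r).
  apply/weight_spaceP; apply: bidx_cases => k kP; rewrite ?wx ?wy //;
    case/c1: kP => [->|->|->|[->|->]] // _; rewrite basis_y4y5 !formE !fxy //=.
  + by field.
  + by rewrite xV ?wx //; ring.
  by rewrite xV ?wx //; ring.
- move=> x /weight_spaceP xV; exists (form (e (bx 2)) x / r).
  apply/weight_spaceP; apply: bidx_cases => k kP; rewrite ?wx ?wy //;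
    case/c1: kP => [->|->|->|[->|->]] // _; rewrite wE !formE !fxy //=.
  + by field.
  + by rewrite xV ?wx //; ring.
  + by rewrite xV ?wx //; ring.
  by rewrite xV ?wx //; ring.
rewrite -/u uaE memvZ //; apply/weight_spaceP; apply: bidx_cases => k kP;
  rewrite ?wx ?wy //; case/c1: kP => [->|->|->|[->|->]] // _; by rewrite fxy.
Qed.

End GivenBy.

Lemma given_byP (F : fieldType) (L : saa F) (r : F) :
  given_by L (P10_2_4 r) -> exists e : bidx -> L, [/\ standard_basis e,
    forall a b c s, (a, b, c, s) \in P10_2_4 r -> tri (e a) (e b) (e c) = s
    & forall a b c, unlisted a b c -> tri (e a) (e b) (e c) = 0].
Proof.
move=> [e [se lis unl]]; exists e; split=> // a b c abc.
by apply: unl; apply/unlistedP.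
Qed.

(** The isomorphism carries the generators of one presentation to balanced
    generators of the other algebra, so s^2 = m^11 r^2.  As 2 and 11 are
    coprime, s/r is then itself an eleventh power. *)
Lemma same_algebra_ratio (F : fieldType) (r s : F) : r != 0 -> s != 0 ->
  same_algebra (P10_2_4 r) (P10_2_4 s) -> exists a : F, a != 0 /\ s / r = a ^+ 11.
Proof.
move=> r0 s0 [L [M [/given_byP[e [se lis unl]] /given_byP[e' [se' lis' unl']] [f [bf fm ff]]]]].
have [h fK hK] := bf.
have hm x y : h (mul x y) = mul (h x) (h y).
  by apply: (can_inj fK); rewrite fm !hK.
have hf x y : form (h x) (h y) = form x y by rewrite -ff !hK.
have bal' := basis_balanced se' lis' unl'.
have tw' := basis_twist se' lis' unl'.
have tw := basis_twist se lis unl.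
set a := e' (by_ 4) in bal' tw'; set b := e' (by_ 5) in bal' tw'.
have [|||m] := @balanced_twist _ _ _ _ _ _ (weight_filtration se unl) _ _ (h a) (h b)
  (basis_generators se lis unl r0) (basis_balanced se lis unl).
- by rewrite /balanced -!hm bal'.
- by rewrite tw expf_neq0.
- by rewrite /twist -!hm hf -/(twist a b) tw' expf_neq0.
have -> : twist (h a) (h b) = s ^+ 2 by rewrite /twist -!hm hf -/(twist a b) tw'.
rewrite tw => E.
have m0 : m != 0.
  by apply: contraTneq (expf_neq0 2 s0) => m0; rewrite E m0 expr0n mul0r eqxx.
(* with q = s/r and q^2 = m^11: (q / m^5)^11 = q * (q^2)^5 / m^55 = q *)
exists (s / r / m ^+ 5); split; first by rewrite !mulf_neq0 ?invr_eq0 ?expf_neq0.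
have E5 : (s / r) ^+ 10 = m ^+ 55.
  have -> : (s / r) ^+ 10 = (s ^+ 2 / r ^+ 2) ^+ 5 by field.
  by rewrite E mulfK ?expf_neq0 // -exprM.
rewrite expr_div_n -exprM exprS E5 mulfK // expf_neq0 //.
Qed.

(** * A model of the presentation *)

Section Model.

Variables (F : fieldType) (r : F).
Local Notation V := 'M[F]_(2, 5).
Implicit Types u v w : V.

(** The two rows of a matrix hold the coordinates with respect to the x_i and
    the y_i. *)
Definition coord2 (a : bidx) v : F :=
  match a with inl i => v 0 i | inr i => v 1 i end.

Definition delta2 (a : bidx) : V :=
  match a with inl i => delta_mx 0 i | inr i => delta_mx 1 i end.

Definition det3 (t : bidx * bidx * bidx) u v w : F :=
  let: (a, b, c) := t in
  coord2 a u * (coord2 b v * coord2 c w - coord2 c v * coord2 b w)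
  - coord2 b u * (coord2 a v * coord2 c w - coord2 c v * coord2 a w)
  + coord2 c u * (coord2 a v * coord2 b w - coord2 b v * coord2 a w).

Definition mtri u v w : F := \sum_(p <- P10_2_4 r) p.2 * det3 p.1 u v w.

Definition mform u v : F := \sum_i (u 0 i * v 1 i - u 1 i * v 0 i).

(** The product is forced by the trilinear form: the x_i-coordinate of uv is
    (uv, y_i) and its y_i-coordinate is - (uv, x_i). *)
Definition mmul u v : V :=
  \matrix_(k, i) if k == 0 then mtri u v (delta2 (inr i)) else - mtri u v (delta2 (inl i)).

Lemma coord2P k u v a : coord2 a (k *: u + v) = k * coord2 a u + coord2 a v.
Proof. by case: a => i /=; rewrite !mxE. Qed.

Lemma mtri_cycle u v w : mtri u v w = mtri v w u.
Proof. by apply: eq_bigr => -[[[a b] c] s] _ /=; congr (_ * _); ring. Qed.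

Lemma mtri_alt u w : mtri u u w = 0.
Proof. by rewrite /mtri big1 // => -[[[a b] c] s] _ /=; ring. Qed.

Lemma mtri_linear k u v w w' : mtri u v (k *: w + w') = k * mtri u v w + mtri u v w'.
Proof.
rewrite /mtri mulr_sumr -big_split; apply: eq_bigr => -[[[a b] c] s] _ /=.
by rewrite !coord2P; ring.
Qed.

Lemma mform_is_bilinear : bilinear_for
  (GRing.Scale.Law.clone _ _ *%R _) (GRing.Scale.Law.clone _ _ *%R _) mform.
Proof.
by split=> [w|w] k u v /=; rewrite /mform mulr_sumr -big_split;
  apply: eq_bigr => i _ /=; rewrite !mxE; ring.
Qed.

HB.instance Definition _ := bilinear_isBilinear.Build F V V F
  (GRing.Scale.Law.clone _ _ *%R _) (GRing.Scale.Law.clone _ _ *%R _)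
  mform mform_is_bilinear.

Lemma mmul_is_bilinear : bilinear_for
  (GRing.Scale.Law.clone _ _ *:%R _) (GRing.Scale.Law.clone _ _ *:%R _) mmul.
Proof.
split=> [w|w] k u v /=; apply/matrixP => i j; rewrite !mxE.
  by rewrite !(mtri_cycle _ w) !mtri_linear; case: ifP => _; ring.
by rewrite -!(mtri_cycle _ w) !mtri_linear; case: ifP => _; ring.
Qed.

HB.instance Definition _ := bilinear_isBilinear.Build F V V V
  (GRing.Scale.Law.clone _ _ *:%R _) (GRing.Scale.Law.clone _ _ *:%R _)
  mmul mmul_is_bilinear.

Lemma delta2_expand w :
  w = \sum_i (w 0 i *: delta2 (inl i) + w 1 i *: delta2 (inr i)).
Proof.
rewrite big_split {1}[w]matrix_sum_delta big_ord_recl big_ord1.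
by have -> : lift ord0 ord0 = 1 :> 'I_2 by apply: val_inj.
Qed.

Lemma mform_mmul u v w : mform (mmul u v) w = mtri u v w.
Proof.
have lin0 : mtri u v 0 = 0.
  by rewrite /mtri big1 // => -[[[[i|i] [j|j]] [k|k]] s] _ /=; rewrite !mxE; ring.
rewrite [in RHS](delta2_expand w) /mform.
elim/big_rec2: _ => [|i x y _ IH]; first by rewrite lin0.
by rewrite -[in RHS]addrA !mtri_linear -IH !mxE /=; ring.
Qed.

Lemma mform_alt u : mform u u = 0.
Proof. by rewrite /mform big1 // => i _; ring. Qed.

Lemma mform_delta u a :
  mform u (delta2 a) = match a with inl i => - u 1 i | inr i => u 0 i end.
Proof.
rewrite /mform; case: a => i; rewrite (bigD1 i) //= big1 => [|j ji].
- by rewrite !mxE !eqxx /=; ring.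
- by rewrite !mxE (negbTE ji) ?andbF /=; ring.
- by rewrite !mxE !eqxx /=; ring.
by rewrite !mxE (negbTE ji) ?andbF /=; ring.
Qed.

Lemma mform_nondeg u : (forall v, mform u v = 0) -> u = 0.
Proof.
move=> u0; rewrite [u]delta2_expand big1 // => i _.
have := u0 (delta2 (inr i)); have := u0 (delta2 (inl i)).
rewrite !mform_delta => /eqP; rewrite oppr_eq0 => /eqP -> ->.
by rewrite !scale0r addr0.
Qed.

Lemma mmul_alt u : mmul u u = 0.
Proof. by apply/matrixP => i j; rewrite !mxE !mtri_alt oppr0 if_same. Qed.

Lemma mform_mmul_cycle u v w : mform (mmul u v) w = mform (mmul v w) u.
Proof. by rewrite !mform_mmul mtri_cycle. Qed.

Definition model : saa F :=
  @SAA F V mform mmul mform_alt mform_nondeg mmul_alt mform_mmul_cycle.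

Lemma coord2_delta2 a b : coord2 a (delta2 b) = (code a == code b)%:R.
Proof.
rewrite (inj_eq code_inj).
by case: a b => [i|i] [j|j]; rewrite /= mxE ?eqxx //.
Qed.

(** Each of the six terms of the determinant vanishes unless it matches the two
    triples up to a permutation. *)
Lemma det3_delta2 a b c i j k :
  ~~ perm_eq [:: code i; code j; code k] [:: code a; code b; code c] ->
  det3 (a, b, c) (delta2 i) (delta2 j) (delta2 k) = 0.
Proof.
move=> np.
have Z x y z : perm_eq [:: x; y; z] [:: code a; code b; code c] ->
    (x == code i)%:R * (y == code j)%:R * (z == code k)%:R = 0 :> F.
  move=> pxyz; rewrite -!natrM !mulnb; case: andP => // -[/andP[/eqP xi /eqP yj] /eqP zk].
  by case/negP: np; rewrite -xi -yj -zk.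
rewrite /det3 !coord2_delta2 !mulrBr !mulrA !Z ?subr0 ?addr0 //;
  by apply/permP => p /=; lia.
Qed.

Arguments coord2 : simpl never.
Arguments delta2 : simpl never.

Lemma model_given_by : given_by model (P10_2_4 r).
Proof.
have dM : \dim {:model} = 10%N by rewrite dimvf.
exists delta2; split.
- apply: gram_basis dM _ => a b; rewrite [form _ _]mform_delta.
  by case: a b => [i|i] [j|j]; rewrite /delta2 /= mxE /= ?eqxx ?oppr0 //= eq_sym.
- move=> a b c s; rewrite !inE => /or4P[|||/orP[]] /eqP[-> -> -> ->];
    rewrite [LHS]mform_mmul /mtri !big_cons big_nil /= /det3 !coord2_delta2;
    rewrite !code_bx ?code_by //=; ring.
move=> a b c np; rewrite [LHS]mform_mmul /mtri big_seq big1 // => -[[[i j] k] s] pP.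
rewrite det3_delta2 ?mulr0 //; apply: contra (np _ pP).
exact: (perm_map_inj code_inj (s := [:: a; b; c]) (t := [:: i; j; k])).
Qed.

End Model.

(** * Rescaling the presentation *)

Section Rescale.

Variables (F : fieldType) (L : saa F).

(** Scaling y_i by t_i and x_i by its inverse leaves the standard basis
    standard.  The four entries equal to 1 stay equal to 1 for
    (t_1, ..., t_5) = (m^-1, m^-3, m^-5, m^4, m^2), and r is multiplied by
    t_4 t_5 / t_3 = m^11. *)
Lemma given_by_rescale r s m : m != 0 -> s = r * m ^+ 11 ->
  given_by L (P10_2_4 r) -> given_by L (P10_2_4 s).
Proof.
move=> m0 sE [e [se lis unl]].
pose k a := nth 0 [:: m; m ^+ 3; m ^+ 5; m ^- 4; m ^- 2;
                      m^-1; m ^- 3; m ^- 5; m ^+ 4; m ^+ 2] (code a).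
have dL : \dim {:L} = 10%N.
  have [/andP[/eqP <- /eqnP ->] _ _ _] := se.
  by rewrite size_codom card_sum !card_ord.
exists (fun a => k a *: e a); split.
- apply: gram_basis dL _ => a b; rewrite formZl formZr (std_gram se).
  have kk i : k (inl i) * k (inr i) = 1 by rewrite /k; ord5 i => /=; field.
  case: a b => [i|i] [j|j] /=; rewrite ?mulr0 //;
    case: (eqVneq i j) => [->|_]; rewrite ?oppr0 ?mulr0 // ?mulrN mulr1 ?kk //.
  by rewrite [k (inr j) * _]mulrC kk.
- move=> a b c t; rewrite saa_mulZl saa_mulZr !formZl formZr !inE.
  move=> /or4P[|||/orP[]] /eqP[-> -> -> ->].
  - by rewrite (lis _ _ _ r) ?inE ?eqxx // sE /k code_bx ?code_by //=; ring.
  - by rewrite (lis _ _ _ 1) ?inE ?eqxx ?orbT // /k code_bx ?code_by //=; field.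
  - by rewrite (lis _ _ _ 1) ?inE ?eqxx ?orbT // /k code_bx ?code_by //=; field.
  - by rewrite (lis _ _ _ 1) ?inE ?eqxx ?orbT // /k code_bx ?code_by //=; field.
  by rewrite (lis _ _ _ 1) ?inE ?eqxx ?orbT // /k !code_by //=; field.
move=> a b c np; rewrite saa_mulZl saa_mulZr !formZl formZr unl ?mulr0 //.
by apply/unlistedP/(unlistedP s).
Qed.

End Rescale.

Lemma same_algebra_of_ratio (F : fieldType) (r s a : F) : r != 0 -> a != 0 ->
  s / r = a ^+ 11 -> same_algebra (P10_2_4 r) (P10_2_4 s).
Proof.
move=> r0 a0 sr; exists (model r), (model r); split; first exact: model_given_by.
  apply: (given_by_rescale a0 _ (model_given_by r)).
  by rewrite -sr mulrC divfK.
exists idfun; split=> //; by exists idfun.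
Qed.

(** * Classification *)

Theorem proposition8p5 (F : fieldType) :
  (forall L : saa F,
     \dim {:L} = 10%N ->
     nilpotent L ->
     isotropic (saa_center L) ->
     \dim (saa_center L) = 2%N ->
     nilpotent_class L 7 ->
     saa_prodv (saa_power L 4) (saa_power L 3) = saa_power L 7 ->
     (let U := (saa_power L 4 :&:
                  saa_transp (saa_power L 3)
                    (saa_prodv (saa_power L 5) (saa_power L 2)))%VS in
      \dim (saa_prodv U (saa_power L 2)) = 2%N) ->
     exists r : F, r != 0 /\ given_by L (P10_2_4 r)) /\
  (forall r s : F, r != 0 -> s != 0 ->
     same_algebra (P10_2_4 r) (P10_2_4 s) <->
     exists a : F, a != 0 /\ s / r = a ^+ 11).
Proof.
split=> [L dL _ _ _ c7 L43 dU|r s r0 s0]; first exact: class7_given_by.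
split; first exact: same_algebra_ratio.
by case=> a [a0 sr]; exact: same_algebra_of_ratio a0 sr.
Qed.
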